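(* There exists a universal constant $c>0$ such that the following holds for every integer $n\ge1$. Let $w,v\in\mathbb{R}^n$ with $\|w\|_2=\|v\|_2=1$ and $\rho=\langle w,v\rangle\ge0$. Let $f,g:\mathbb{R}\to[0,1]$ be non-decreasing and left-continuous, and set, for $x\in\mathbb{R}^n$, $$F(x)=f(\langle w,x\rangle),\qquad G(x)=g(\langle v,x\rangle).$$ Then $$\mathrm{Cov}_\gamma(F,G)\ \ge\ c\,\frac{\mathcal{W}^{(\gamma)}_1(F,G)}{\sqrt{\log\frac{e}{\mathcal{W}^{(\gamma)}_1(F,F)}}\ \sqrt{\log\frac{e}{\mathcal{W}^{(\gamma)}_1(G,G)}}}.$$
   Context: $\gamma$ is the standard Gaussian measure $N(0,I_n)$ on $\mathbb{R}^n$, and $\mathrm{Cov}_\gamma(F,G)=\mathbb{E}_\gamma[FG]-\mathbb{E}_\gamma[F]\,\mathbb{E}_\gamma[G]$. For bounded measurable $F,G:\mathbb{R}^n\to\mathbb{R}$, $\mathcal{W}^{(\gamma)}_1(F,G)=\sum_{k=1}^n\mathbb{E}_\gamma[F\cdot\mathbf{x}_k]\,\mathbb{E}_\gamma[G\cdot\mathbf{x}_k]$, where $\mathbf{x}_k(x)=x_k$ is the $k$-th coordinate function. If $\mathcal{W}^{(\gamma)}_1(F,F)=0$ or $\mathcal{W}^{(\gamma)}_1(G,G)=0$, the right-hand side of the inequality is read as $0$. *)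

(* Defs.v *)
From HB Require Import structures.
From mathcomp Require Import all_boot all_order all_algebra.
From mathcomp Require Import all_classical all_reals all_analysis.

Set Implicit Arguments.
Unset Strict Implicit.
Unset Printing Implicit Defensive.

Import Order.TTheory GRing.Theory Num.Theory.
Import numFieldNormedType.Exports.

Local Open Scope classical_set_scope.
Local Open Scope ring_scope.

(* R^n is n.-tuple R, on which the library puts the product of the Borel
   sigma-algebras of R. *)

Definition dotp (R : realType) (n : nat) (x y : n.-tuple R) : R :=
  \sum_(k < n) tnth x k * tnth y k.

Definition norm2 (R : realType) (n : nat) (x : n.-tuple R) : R :=
  Num.sqrt (dotp x x).

(* measurableTypeR R is R with its Borel sigma-algebra, under the display on
   which normal_prob is a measure. *)
Definition tuple_cons (R : realType) (n : nat)
    (p : measurableTypeR R * n.-tuple R) : n.+1.-tuple R :=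
  [tuple of (p.1 : R) :: p.2].

Lemma measurable_tuple_cons (R : realType) (n : nat) :
  measurable_fun [set: measurableTypeR R * n.-tuple R] (@tuple_cons R n).
Proof.
by apply: (@measurable_cons _ _ _ R (fun p => p.1 : R) n snd) => //;
  exact: measurable_fst.
Qed.

HB.instance Definition _ (R : realType) (n : nat) :=
  isMeasurableFun.Build _ _ _ _ (@tuple_cons R n)
    (@measurable_tuple_cons R n).

(* N(0, I_n) as the n-fold product of N(0, 1); the arguments 0 and 1 of
   normal_prob are the mean and the standard deviation. *)
Fixpoint std_gaussian (R : realType) (n : nat) : probability (n.-tuple R) R :=
  match n with
  | 0 => dirac [tuple]
  | m.+1 => distribution (normal_prob 0 1 \x std_gaussian R m)%E (@tuple_cons R m)
  end.

Lemma std_gaussian_box (R : realType) (n : nat) (A : 'I_n -> set R)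
    (mA : forall k, measurable (A k)) :
  std_gaussian R n [set x | forall k, A k (tnth x k)] =
  (\prod_(k < n) normal_prob 0 1 (A k))%E.
Proof.
elim: n A mA => [|n IHn] A mA.
  by rewrite big_ord0 /= diracE mem_set//= => -[].
rewrite big_ord_recl -IHn// /= /distribution /pushforward /=.
have mB : measurable
    [set x : n.-tuple R | forall k, A (lift ord0 k) (tnth x k)].
  have -> : [set x : n.-tuple R | forall k, A (lift ord0 k) (tnth x k)] =
      \bigcap_(k in [set: 'I_n])
        ((fun x : n.-tuple R => tnth x k) @^-1` A (lift ord0 k)).
    by apply/seteqP; split=> x /= h k; [move=> _|]; apply: h.
  apply: fin_bigcap_measurable => // k _.
  by rewrite -[X in measurable X]setTI; apply: measurable_tnth.
have mA0 : measurable (A ord0 : set (measurableTypeR R)) by exact: mA.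
rewrite -product_measure1E//.
congr (product_measure1 _ _ _); apply/seteqP; split=> -[a t] /=.
  move=> h; split; first exact: (h ord0).
  by move=> k; have := h (lift ord0 k); rewrite tnthS.
move=> [h0 h] k; case: (unliftP ord0 k) => [j ->|->//].
by rewrite tnthS; apply: h.
Qed.

(* [fine] is harmless: it is applied only to integrable functions. *)
Definition gexp (R : realType) (n : nat) (F : n.-tuple R -> R) : R :=
  fine ('E_(std_gaussian R n)[F])%E.

Definition gcov (R : realType) (n : nat) (F G : n.-tuple R -> R) : R :=
  gexp (fun x => F x * G x) - gexp F * gexp G.

Definition W1 (R : realType) (n : nat) (F G : n.-tuple R -> R) : R :=
  \sum_(k < n) gexp (fun x => F x * tnth x k) * gexp (fun x => G x * tnth x k).

Definition talagrand_ratio (R : realType) (n : nat) (F G : n.-tuple R -> R) : R :=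
  if (W1 F F == 0) || (W1 G G == 0) then 0
  else W1 F G / (Num.sqrt (ln (expR 1 / W1 F F)) *
                 Num.sqrt (ln (expR 1 / W1 G G))).

(* Main.v *)
Require Import Defs.
From mathcomp Require Import all_boot all_order all_algebra.
From mathcomp Require Import all_classical all_reals all_analysis.
From mathcomp Require Import measurable_realfun ring lra.

(* The pair (<w, x>, <v, x>) is standard bivariate Gaussian with correlation
   rho = <w, v>, so with a = E[f(Z) Z] and b = E[g(Z) Z] one has
   W1(F, F) = a^2, W1(G, G) = b^2, W1(F, G) = rho a b, and
   E[F G] = E[f P_rho g], where P_r g (x) = E[g(r x + sqrt(1 - r^2) Z)].
   For monotone f and g, exchangeability makes E[f P_r g] nondecreasing in r, so
   rho may be lowered to r = rho / (2 S T), where S and T are cut-offs, of order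
   sqrt(log(e/a^2)) and sqrt(log(e/b^2)), beyond which the tails of the Gaussian
   contribute at most half of a and of b.  For such a small r the function
   P_r g has slope at least c r b on [-S, S]: comparing the Gaussian densities
   centred at r x and at r x' only costs a constant on the window |y| <= T.
   Hence P_r g - c r b clip_S is still nondecreasing, and the association
   inequality gives
   Cov(f, P_r g) >= c r b E[f clip_S] >= c r b a / 2. *)

Import Order.TTheory GRing.Theory Num.Theory.
Import numFieldNormedType.Exports.

Local Open Scope classical_set_scope.
Local Open Scope ring_scope.

Set Implicit Arguments.
Unset Strict Implicit.

(** * Change of variables in Gaussian integrals *)

(** The obstacle is correlation close to 1: when [g] is a step, [P_r g] is then nearly a step too,
    and no slope of order [b] holds throughout the window. Strong noise spreads the increments of
    [g] over all [x]. Moving the centre of the kernel to [r x] distorts the density at [y] by a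
    factor of about [exp (r x y)], which stays bounded for [|x| <= S], [|y| <= T] only if [r S T] is
    bounded. This forces the factor [1 / (2 S T)], and that loss is exactly the product of the two
    square roots of logarithms. Slopes are measured by increments, without derivatives: folding [y]
    onto [- y] about the midpoint of two centres turns an increment of [P_r g] into a rearrangement
    inequality. The bounded function [P_r g] cannot grow linearly on the whole line, hence the
    truncated identity in place of [x]; being odd, it has mean 0 and drops out of the product of
    expectations. The constant [exp (-2) / 512] collects [exp (-2) / 4] from the slope, [1 / 2] from
    each truncated moment, and [1 / 32] from [2 S T] with cut-offs at most four times the square
    roots. *)

Section affine.
Context {R : realType}.
Local Notation mu := (@lebesgue_measure R).
Local Open Scope ereal_scope.

Local Notation affine c d :=
  ((fun x => c * x + d)%R : measurableTypeR R -> measurableTypeR R).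

Lemma measurable_affine (c d : R) :
  measurable_fun setT (affine c d).
Proof. by apply: measurable_funD => //; apply: measurable_funM. Qed.

(** Lebesgue measure is determined by its values on half-open intervals, and [c] times its image
    under the affine map gives each of them its length. *)
Lemma ge0_integral_affine_gt0 (c d : R) (f : R -> \bar R) :
  (0 < c)%R -> measurable_fun [set: R] f -> (forall x, 0 <= f x) ->
  \int[mu]_x f x = c%:E * \int[mu]_x f (c * x + d)%R.
Proof.
move=> c0 mf f0.
have mA := measurable_affine c d.
pose C := NngNum (ltW c0).
have E A : measurable A ->
    mu A = mscale C (pushforward mu (affine c d)) A.
  apply: (@lebesgue_measure_unique R (mscale C (pushforward mu (affine c d)))).
  move=> _ [[a b] _ <-].
  have E : (affine c d) @^-1` `]a, b]%classic =
      `]((a - d) / c)%R, ((b - d) / c)%R]%classic.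
    apply/seteqP; split => x /=; rewrite !in_itv /= ltr_pdivrMr// ler_pdivlMr//;
      move=> /andP[h1 h2]; apply/andP; split; move: h1 h2; rewrite (mulrC c); lra.
  change (mu `]a, b]%classic = c%:E * mu (affine c d @^-1` `]a, b]%classic)).
  rewrite E !lebesgue_measure_itv/= !lte_fin ltr_pM2r ?invr_gt0// ltrD2r.
  case: ifPn => ab; last by rewrite mule0.
  rewrite -!EFinB -EFinM; congr EFin; field; lra.
rewrite [LHS](@eq_measure_integral _ _ _ _
  (mscale C (pushforward mu (affine c d)))); last first.
  by move=> A mA' _; exact: (E mA).
rewrite ge0_integral_mscale//.
by rewrite ge0_integral_pushforward.
Qed.

Lemma ge0_integralN (f : R -> \bar R) :
  measurable_fun [set: R] f -> (forall x, 0 <= f x) ->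
  \int[mu]_x f (- x)%R = \int[mu]_x f x.
Proof.
move=> mf f0.
rewrite [RHS](@eq_measure_integral _ _ _ _
   (pushforward mu (-%R : measurableTypeR R -> measurableTypeR R))).
  by rewrite ge0_integral_pushforward//; exact: measurable_oppr.
by move=> A mA _; exact/esym/lebesgue_measureN.
Qed.

Lemma ge0_integral_affine (c d : R) (f : R -> \bar R) :
  (c != 0)%R -> measurable_fun [set: R] f -> (forall x, 0 <= f x) ->
  \int[mu]_x f x = `|c|%R%:E * \int[mu]_x f (c * x + d)%R.
Proof.
move=> c0 mf f0; have [cp|cn] := ltP 0%R c.
  by rewrite gtr0_norm//; exact: ge0_integral_affine_gt0.
have cn0 : (0 < - c)%R by rewrite oppr_gt0 lt_neqAle c0.
rewrite (ge0_integral_affine_gt0 d cn0)// ler0_norm//; congr (_ * _).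
rewrite -[RHS]ge0_integralN//.
  by apply: eq_integral => x _; rewrite mulrN mulNr.
by apply: measurableT_comp => //; exact: measurable_affine.
Qed.

End affine.

(** * Reflection invariance of the planar Gaussian measure *)

Section gaussian_density.
Context {R : realType}.
Local Notation mu := (@lebesgue_measure R).
Local Notation g := (@normal_prob R 0 1).
Local Notation phi := (@normal_pdf R 0 1).
Local Open Scope ereal_scope.

(** The change of measure goes through the Radon-Nikodym derivative, fixed only up to null sets; it
    agrees with [phi] almost everywhere because both integrate to [g E] over every measurable
    [E]. *)
Lemma ge0_integral_normal_prob (f : R -> \bar R) :
  measurable_fun [set: R] f -> (forall x, 0 <= f x) ->
  \int[g]_x f x = \int[mu]_x (f x * (phi x)%:E).
Proof.
move=> mf f0.
have gmu : g `<< mu by exact: normal_prob_dominates.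
rewrite -(Radon_Nikodym_SigmaFinite.change_of_variables gmu)//.
have mpdf : measurable_fun setT (fun x => (phi x)%:E).
  by apply/measurable_EFinP; exact: measurable_normal_pdf.
have irn := Radon_Nikodym_SigmaFinite.f_integrable gmu.
apply: ge0_ae_eq_integral => //.
- by apply: emeasurable_funM => //; exact: measurable_int irn.
- exact: emeasurable_funM.
- by move=> x _; apply: mule_ge0 => //; exact: Radon_Nikodym_SigmaFinite.f_ge0.
- by move=> x _; apply: mule_ge0 => //; rewrite lee_fin normal_pdf_ge0.
- apply: ae_eqe_mul2l; apply: integral_ae_eq => //.
  by move=> E _ mE; rewrite -Radon_Nikodym_SigmaFinite.f_integral.
Qed.

Lemma normal_pdf01E (x : R) : phi x = (normal_peak 1 * expR (- (x ^+ 2) / 2))%R.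
Proof. by rewrite normal_pdfE ?oner_eq0// /normal_fun subr0 expr1n. Qed.

Lemma ge0_integral_gaussN (f : R -> \bar R) :
  measurable_fun [set: R] f -> (forall x, 0 <= f x) ->
  \int[g]_x f (- x)%R = \int[g]_x f x.
Proof.
move=> mf f0; rewrite !ge0_integral_normal_prob//; last first.
  by apply: measurableT_comp => //; exact: measurable_oppr.
have mfp : measurable_fun setT (fun x => f x * (phi x)%:E).
  by apply: emeasurable_funM => //; apply/measurable_EFinP; exact: measurable_normal_pdf.
have fp0 x : 0 <= f x * (phi x)%:E.
  by apply: mule_ge0 => //; rewrite lee_fin normal_pdf_ge0.
rewrite -(ge0_integralN mfp fp0).
by apply: eq_integral => x _; rewrite !normal_pdf01E sqrrN.
Qed.

Lemma normal_pdf01_ge0 (x : R) : 0 <= (phi x)%:E.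
Proof. by rewrite lee_fin normal_pdf_ge0. Qed.

Lemma measurable_normal_pdf01 d (T : measurableType d) (h : T -> R) :
  measurable_fun setT h -> measurable_fun setT (fun x => (phi (h x))%:E).
Proof.
move=> mh; apply/measurable_EFinP/measurableT_comp => //.
exact: measurable_normal_pdf.
Qed.

Lemma ge0_integral_gauss2 (F : R * R -> \bar R) :
  measurable_fun [set: R * R] F -> (forall x, 0 <= F x) ->
  \int[g]_x \int[g]_y F (x, y) =
  \int[mu]_x \int[mu]_y (F (x, y) * ((phi y)%:E * (phi x)%:E)).
Proof.
move=> mF F0.
have mF2 x : measurable_fun setT (fun y => F (x, y)).
  exact: (measurableT_comp mF (measurable_pair1 x)).
rewrite ge0_integral_normal_prob; last 2 first.
- exact: (@measurable_fun_fubini_tonelli_F _ _ _ _ R g F mF F0).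
- by move=> x; apply: integral_ge0.
apply: eq_integral => x _.
rewrite (ge0_integral_normal_prob (mF2 x))//.
rewrite -ge0_integralZr//.
- by apply: eq_integral => y _; rewrite muleA.
- by apply: emeasurable_funM; [exact: mF2|exact: (@measurable_normal_pdf01 _ R id)].
- by move=> y _; apply: mule_ge0 => //; exact: normal_pdf01_ge0.
- exact: normal_pdf01_ge0.
Qed.

(* For a fixed value of the first variable, substitute the first coordinate of
   the reflected point for the second variable; then, for a fixed value of
   that coordinate, the second one for the first. *)
Lemma gauss_reflection_neq0 (c s : R) (F : R * R -> \bar R) :
  (s != 0)%R -> (c ^+ 2 + s ^+ 2 = 1)%R ->
  measurable_fun [set: R * R] F -> (forall x, 0 <= F x) ->
  \int[g]_x \int[g]_y F (c * x + s * y, s * x - c * y)%R =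
  \int[g]_x \int[g]_y F (x, y).
Proof.
move=> s0 cs mF F0.
have mlin (a b : R) : measurable_fun [set: R * R] (fun p : R * R => a * p.1 + b * p.2)%R.
  by apply: measurable_funD; apply: measurable_funM => //.
have mlin2 (a b a' b' : R) : measurable_fun [set: R * R]
    (fun p : R * R => F (a * p.1 + b * p.2, a' * p.1 + b' * p.2)%R).
  by apply: (measurableT_comp mF); apply: measurable_fun_pair => /=; exact: mlin.
rewrite (@ge0_integral_gauss2
  (fun p => F (c * p.1 + s * p.2, s * p.1 - c * p.2)%R))//=; last first.
  by have := mlin2 c s s (- c)%R; under eq_fun do rewrite mulNr.
rewrite (ge0_integral_gauss2 mF F0).
(* [K (u, x)] is the integrand after the substitution [u = c x + s y]: by [c^2 + s^2 = 1] the
   reflected point is [(u, (x - c u) / s)], and [|1 / s|] is the Jacobian. *)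
pose K (p : R * R) := F (p.1, (p.2 - c * p.1) / s)%R *
  ((phi ((p.1 - c * p.2) / s)%R)%:E * (phi p.2)%:E) * (`|s^-1|%R)%:E.
have mK : measurable_fun setT K.
  apply: emeasurable_funM => //; apply: emeasurable_funM => //.
    have := mlin2 1%R 0%R (- c / s)%R (s^-1)%R; congr (measurable_fun _ _).
    by apply/funext => p; congr (F (_, _)); field.
  apply: emeasurable_funM; apply: measurable_normal_pdf01 => //.
  have := mlin (s^-1)%R (- c / s)%R; congr (measurable_fun _ _).
  by apply/funext => p; field.
have K0 p : 0 <= K p.
  by rewrite !mule_ge0// ?normal_pdf01_ge0// lee_fin.
transitivity (\int[mu]_x \int[mu]_u K (u, x)).
  apply: eq_integral => x _.
  have sV0 : (s^-1 != 0)%R by rewrite invr_eq0.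
  rewrite [LHS](ge0_integral_affine (- (c * x) / s)%R sV0); last 2 first.
  - apply: emeasurable_funM.
      have := measurableT_comp (mlin2 c s s (- c)%R) (measurable_pair1 x).
      by congr (measurable_fun _ _); apply/funext => y /=; rewrite mulNr.
    apply: emeasurable_funM; last exact: measurable_cst.
    exact: (@measurable_normal_pdf01 _ R id).
  - by move=> y; rewrite !mule_ge0// normal_pdf01_ge0.
  rewrite -ge0_integralZl//; last 2 first.
  - apply: emeasurable_funM.
      have := measurableT_comp
        (measurableT_comp (mlin2 c s s (- c)%R) (measurable_pair1 x))
        (measurable_affine s^-1%R (- (c * x) / s)%R).
      by congr (measurable_fun _ _); apply/funext => y /=; rewrite !mulNr.
    apply: emeasurable_funM; last exact: measurable_cst.
    by apply: measurable_normal_pdf01; exact: measurable_affine.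
  - by move=> y _; rewrite !mule_ge0// normal_pdf01_ge0.
  apply: eq_integral => u _; rewrite /K /= muleC.
  have -> : (c * x + s * (s^-1 * u + - (c * x) / s) = u)%R by field.
  have -> : (s^-1 * u + - (c * x) / s = (u - c * x) / s)%R by field.
  congr (F (_, _) * _ * _).
  have {3}-> : (x = (c ^+ 2 + s ^+ 2) * x)%R by rewrite cs mul1r.
  by field.
rewrite -(@fubini_tonelli _ _ _ _ _ mu mu K mK K0).
apply: eq_integral => u _.
rewrite [LHS](ge0_integral_affine (c * u)%R s0); last 2 first.
- exact: (measurableT_comp mK (measurable_pair1 u)).
- by move=> y; exact: K0.
rewrite -ge0_integralZl//; last first.
  exact: (measurableT_comp (measurableT_comp mK (measurable_pair1 u))
    (measurable_affine s (c * u)%R)).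
apply: eq_integral => v _.
have ss : (`|s^-1|%R)%:E * (`|s|%R)%:E = 1 :> \bar R.
  by rewrite -EFinM -normrM mulVf// normr1.
rewrite /K /= muleC -muleA ss mule1.
have -> : ((s * v + c * u - c * u) / s = v)%R by field.
have -> : ((u - c * (s * v + c * u)) / s = s * u - c * v)%R.
  have {1}-> : (u = (c ^+ 2 + s ^+ 2) * u)%R by rewrite cs mul1r.
  field => //.
(* The Jacobians have cancelled; the products of densities agree because a reflection preserves
   [u^2 + v^2]. *)
congr (_ * _); rewrite -!EFinM; congr EFin; rewrite !normal_pdf01E.
rewrite mulrACA -expRD [RHS]mulrACA -expRD; congr (_ * expR _)%R.
have -> : (- v ^+ 2 / 2 + - u ^+ 2 / 2 = - ((c ^+ 2 + s ^+ 2) * (u ^+ 2 + v ^+ 2)) / 2)%R.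
  by rewrite cs mul1r; field.
by field.
Qed.

End gaussian_density.

(** * Joint law of two linear forms of a Gaussian vector *)

Section gaussian_law.
Context {R : realType}.
Local Notation mu := (@lebesgue_measure R).
Local Notation g := (@normal_prob R 0 1).
Local Open Scope ereal_scope.

(** The substitutions of the generic case divide by [s]. If [s = 0] then [c] is 1 or -1 and the map
    only changes signs, so the symmetry of [g] suffices. *)
Lemma gauss_reflection (c s : R) (F : R * R -> \bar R) :
  (c ^+ 2 + s ^+ 2 = 1)%R ->
  measurable_fun [set: R * R] F -> (forall x, 0 <= F x) ->
  \int[g]_x \int[g]_y F (c * x + s * y, s * x - c * y)%R =
  \int[g]_x \int[g]_y F (x, y).
Proof.
move=> cs mF F0; have [s0|s0] := eqVneq s 0%R; last exact: gauss_reflection_neq0.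
have mF2 x : measurable_fun setT (fun y => F (x, y)).
  exact: (measurableT_comp mF (measurable_pair1 x)).
have mI : measurable_fun setT (fun x => \int[g]_y F (x, y)).
  exact: (@measurable_fun_fubini_tonelli_F _ _ _ _ R g F mF F0).
have I0 x : 0 <= \int[g]_y F (x, y) by apply: integral_ge0.
have H e x : (e = 1 \/ e = -1)%R -> \int[g]_y F (x, e * y)%R = \int[g]_y F (x, y).
  case=> ->.
    by apply: eq_integral => y _; rewrite mul1r.
  rewrite -(ge0_integral_gaussN (mF2 x) (fun y => F0 (x, y))).
  by apply: eq_integral => y _; rewrite mulN1r.
have c1 : (c = 1 \/ c = - 1)%R.
  have : ((c - 1) * (c + 1) == 0)%R.
    by rewrite -subr_sqr expr1n -cs s0 expr0n addr0 subrr.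
  by rewrite mulf_eq0 => /orP[/eqP h|/eqP h]; [left|right]; lra.
transitivity (\int[g]_x \int[g]_y F (c * x, y)%R).
  apply: eq_integral => x _.
  rewrite -(H (- c)%R (c * x)%R); last by case: c1 => ->; [right|left; rewrite opprK].
  by apply: eq_integral => y _; rewrite s0 !mul0r addr0 add0r mulNr.
case: c1 => ->.
  by apply: eq_integral => x _; rewrite mul1r.
rewrite -[RHS](ge0_integral_gaussN mI I0).
by apply: eq_integral => x _; rewrite mulN1r.
Qed.

Lemma polar (a b : R) : exists c s : R, [/\ c ^+ 2 + s ^+ 2 = 1,
  a = Num.sqrt (a ^+ 2 + b ^+ 2) * c & b = Num.sqrt (a ^+ 2 + b ^+ 2) * s]%R.
Proof.
have : (0 <= a ^+ 2 + b ^+ 2)%R by rewrite addr_ge0// sqr_ge0.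
move/sqr_sqrtr; set k := Num.sqrt _ => k2.
have [k0|k0] := eqVneq k 0%R.
  exists 1%R, 0%R; move/eqP: k2; rewrite k0 expr0n/= eq_sym paddr_eq0 ?sqr_ge0//.
  rewrite !sqrf_eq0 => /andP[/eqP-> /eqP->].
  by rewrite mulr0 mulr1 addr0 expr1n.
exists (a / k)%R, (b / k)%R; split; [|field; exact: k0..].
by rewrite !expr_div_n -mulrDl -k2 divff// expf_neq0.
Qed.

(** With [(a, b) = k (c, s)] in polar form, [a x + b y] is [k] times the first coordinate of the
    reflected point, which has the law of [x]. *)
Lemma gauss_add (a b : R) (F : R -> \bar R) :
  measurable_fun [set: R] F -> (forall x, 0 <= F x) ->
  \int[g]_x \int[g]_y F (a * x + b * y)%R =
  \int[g]_x F (Num.sqrt (a ^+ 2 + b ^+ 2) * x)%R.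
Proof.
move=> mF F0; have [c [s []]] := polar a b; set k := Num.sqrt _ => cs ac bs.
have mG : measurable_fun setT (fun p : R * R => F (k * p.1)%R).
  by apply: measurableT_comp => //; apply: measurable_funM => //.
have := gauss_reflection cs mG (fun p => F0 _).
rewrite /= => H.
transitivity (\int[g]_x \int[g]_y F (k * (c * x + s * y))%R).
  by apply: eq_integral => x _; apply: eq_integral => y _; rewrite {1}ac {1}bs mulrDr !mulrA.
rewrite H; apply: eq_integral => x _.
by rewrite integral_cst// [X in _ * X]probability_setT mule1.
Qed.

Lemma measurable_dotp (n : nat) (w : n.-tuple R) :
  measurable_fun [set: n.-tuple R] (dotp w).
Proof.
apply: measurable_sum => k; apply: measurable_funM => //.
exact: measurable_tnth.
Qed.

Lemma dotp_cons (n : nat) (a b : R) (w x : n.-tuple R) :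
  dotp [tuple of a :: w] [tuple of b :: x] = (a * b + dotp w x)%R.
Proof.
rewrite /dotp big_ord_recl !tnth0; congr (_ + _)%R.
by apply: eq_bigr => i _; rewrite !tnthS.
Qed.

(** A Cholesky factorisation of the Gram matrix of [w] and [v]. The entries are constrained through
    the products [a^2], [a b], [b^2 + k^2], without division by [a], because the induction removes a
    coordinate and the rest of [w] may vanish. The signs of [a] and [k] make them computable later
    as square roots. *)
Lemma std_gaussian_dotp2_ge0 (n : nat) (w v : n.-tuple R) :
  exists a b k : R, [/\ (0 <= a)%R, (0 <= k)%R,
    (a ^+ 2 = dotp w w)%R, (a * b = dotp w v)%R & (b ^+ 2 + k ^+ 2 = dotp v v)%R] /\
  forall F : R * R -> \bar R, measurable_fun [set: R * R] F -> (forall x, 0 <= F x) ->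
  \int[std_gaussian R n]_x F (dotp w x, dotp v x) =
  \int[g]_x \int[g]_y F (a * x, b * x + k * y)%R.
Proof.
elim: n w v => [|n IH] w v.
  exists 0%R, 0%R, 0%R; split.
    by rewrite /dotp !big_ord0 expr0n mulr0 addr0.
  move=> F mF F0.
  rewrite integral_dirac//; last first.
    apply: measurableT_comp => //.
    by apply: measurable_fun_pair; exact: measurable_dotp.
  rewrite diracT mul1e /dotp !big_ord0.
  under eq_integral do under eq_integral do rewrite !mul0r addr0.
  under eq_integral do rewrite integral_cst// [X in _ * X]probability_setT mule1.
  by rewrite integral_cst// [X in _ * X]probability_setT mule1.
case/tupleP: w => w0 w; case/tupleP: v => v0 v.
have [a' [b' [k' [[a'0 k'0 a'2 ab' bk'] IHF]]]] := IH w v.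
have [c [s []]] := polar w0 a'; set a := Num.sqrt _ => cs ac as_.
have a2 : (a ^+ 2 = w0 ^+ 2 + a' ^+ 2)%R by rewrite sqr_sqrtr// addr_ge0// sqr_ge0.
(* A new coordinate [z] gives three independent normals. The reflection makes the first form a
   multiple of one of them; [b] and [e] are the coefficients of the second form in the reflected
   coordinates, and the terms in [e] and [k'] then merge into a single normal of size [k]. *)
pose b := (v0 * c + b' * s)%R; pose e := (v0 * s - b' * c)%R.
pose k := Num.sqrt (e ^+ 2 + k' ^+ 2).
have k2 : (k ^+ 2 = e ^+ 2 + k' ^+ 2)%R by rewrite sqr_sqrtr// addr_ge0// sqr_ge0.
exists a, b, k; split.
  rewrite !dotp_cons -a'2 -ab' -bk'; split; rewrite ?sqrtr_ge0//.
  - by rewrite /b ac as_; ring.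
  - rewrite k2 !addrA; congr (_ + _)%R.
    have -> : (b ^+ 2 + e ^+ 2 = (c ^+ 2 + s ^+ 2) * (v0 ^+ 2 + b' ^+ 2))%R.
      by rewrite /b /e; ring.
    by rewrite cs mul1r.
move=> F mF F0.
have mF' x y d (T : measurableType d) (p q : T -> R) :
    measurable_fun setT p -> measurable_fun setT q ->
    measurable_fun setT (fun t => F (x + p t, y + q t)%R).
  move=> mp mq; apply: (measurableT_comp mF).
  by apply: measurable_fun_pair; exact: measurable_funD.
have mD : measurable_fun setT (fun x : n.+1.-tuple R =>
    F (dotp [tuple of w0 :: w] x, dotp [tuple of v0 :: v] x)).
  apply: (measurableT_comp mF).
  by apply: measurable_fun_pair; exact: measurable_dotp.
rewrite [LHS](ge0_integral_distribution _ mD)//.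
rewrite -/std_gaussian.
rewrite fubini_tonelli1//=; last first.
  by apply: (measurableT_comp mD).
rewrite /fubini_F /=.
transitivity (\int[g]_z \int[g]_x \int[g]_y
    F (a * (c * z + s * x), b * (c * z + s * x) + e * (s * z - c * x) + k' * y)%R).
  apply: eq_integral => z _.
  rewrite /tuple_cons /=.
  under eq_integral do rewrite !dotp_cons.
  have mFz : measurable_fun setT (fun p : R * R => F (w0 * z + p.1, v0 * z + p.2)%R).
    exact: mF'.
  rewrite (IHF _ mFz (fun p => F0 _)).
  apply: eq_integral => x _; apply: eq_integral => y _ /=.
  congr (F (_, _)).
    by rewrite {1}ac {1}as_; ring.
  rewrite addrA; congr (_ + _)%R.
  have -> : (b * (c * z + s * x) + e * (s * z - c * x) =
     (c ^+ 2 + s ^+ 2) * (v0 * z + b' * x))%R by rewrite /b /e; ring.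
  by rewrite cs mul1r.
pose G (p : R * R) := \int[g]_y F (a * p.1, b * p.1 + e * p.2 + k' * y)%R.
have mG : measurable_fun setT G.
  apply: (@measurable_fun_fubini_tonelli_F _ _ _ _ R g
    (fun q : (R * R) * R => F (a * q.1.1, b * q.1.1 + e * q.1.2 + k' * q.2)%R)) => //.
  apply: (measurableT_comp mF).
  have m1 : measurable_fun setT (fun q : (R * R) * R => q.1.1).
    by apply: (measurableT_comp measurable_fst).
  have m2 : measurable_fun setT (fun q : (R * R) * R => q.1.2).
    by apply: (measurableT_comp measurable_snd).
  apply: measurable_fun_pair; first exact: measurable_funM.
  by apply: measurable_funD; [apply: measurable_funD|]; apply: measurable_funM.
have G0 p : 0 <= G p by apply: integral_ge0.
rewrite [LHS](gauss_reflection cs mG G0).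
apply: eq_integral => x _; rewrite /G /=.
transitivity (\int[g]_y \int[g]_z F (a * x, b * x + (e * y + k' * z))%R).
  by apply: eq_integral => y _; apply: eq_integral => z _; rewrite addrA.
have mFx : measurable_fun setT (fun t => F (a * x, b * x + t)%R).
  have := @mF' (a * x)%R (b * x)%R _ R (cst 0%R) id (measurable_cst _) (@measurable_id _ _ _).
  by congr (measurable_fun _ _); apply/funext => t; rewrite addr0.
exact: (gauss_add e k' mFx).
Qed.

End gaussian_law.

(** * The Ornstein-Uhlenbeck operators *)

Section gauss_integrable.
Context {R : realType}.
Local Notation mu := (@lebesgue_measure R).
Local Notation g := (@normal_prob R 0 1).

(** Completing the square: [expR (k * z)] times the standard density is [expR (k ^+ 2 / 2)] times
    the density of N(k, 1). *)
Lemma integral_gauss_expR (k : R) :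
  (\int[g]_z (expR (k * z))%:E = (expR (k ^+ 2 / 2))%:E)%E.
Proof.
have mk : measurable_fun setT (fun z : R => expR (k * z)).
  by apply: measurableT_comp => //; exact: measurable_funM.
rewrite ge0_integral_normal_prob; last 2 first.
- exact/measurable_EFinP.
- by move=> x; rewrite lee_fin expR_ge0.
transitivity (\int[mu]_z ((expR (k ^+ 2 / 2))%:E * (normal_pdf k 1 z)%:E))%E.
  apply: eq_integral => z _; rewrite -!EFinM; congr EFin.
  rewrite normal_pdf01E normal_pdfE ?oner_eq0// /normal_fun expr1n mulrCA [RHS]mulrCA -!expRD.
  by congr (_ * expR _)%R; field.
rewrite ge0_integralZl//.
- by rewrite integral_normal_pdf mule1.
- by apply/measurable_EFinP; exact: measurable_normal_pdf.
- by move=> x _; rewrite lee_fin normal_pdf_ge0.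
Qed.

Lemma integrable_gauss_expR (k : R) :
  g.-integrable setT (EFin \o (fun z => expR (k * z))).
Proof.
apply/integrableP; split.
  apply/measurable_EFinP; apply: measurableT_comp => //; exact: measurable_funM.
under eq_integral do rewrite /= ger0_norm ?expR_ge0//.
by rewrite /= integral_gauss_expR ltry.
Qed.

Lemma integrable_gauss_bounded (u : R -> R) (M : R) :
  measurable_fun setT u -> (forall x, `|u x| <= M) ->
  g.-integrable setT (EFin \o u).
Proof.
move=> mu_ uM; apply: (@le_integrable _ _ _ _ _ _ _ (EFin \o cst M)) => //.
- exact/measurable_EFinP.
- by move=> x _ /=; rewrite lee_fin (le_trans (uM x))// ler_norm.
- exact: finite_measure_integrable_cst.
Qed.

(** Reduces the integrability of first moments to that of exponentials. *)
Lemma ler_norm_expR (z : R) : `|z| <= expR z + expR (- z).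
Proof.
have := expR_ge1Dx z; have := expR_ge1Dx (- z).
have := expR_ge0 z; have := expR_ge0 (- z).
by rewrite ler_norml => *; apply/andP; split; lra.
Qed.

Lemma integrable_gauss_expRD :
  g.-integrable setT (EFin \o (fun z : R => expR z + expR (- z))).
Proof.
have h1 := integrable_gauss_expR 1; have h2 := integrable_gauss_expR (- 1).
have := integrableD measurableT h1 h2; apply: eq_integrable => // z _.
by rewrite /= mul1r mulN1r.
Qed.

Lemma integrable_gauss_mul_id (u : R -> R) (M : R) :
  measurable_fun setT u -> (forall x, `|u x| <= M) ->
  g.-integrable setT (EFin \o (fun z => u z * z)).
Proof.
move=> mu_ uM.
have M0 : 0 <= M by exact: le_trans (uM 0).
apply: (@le_integrable _ _ _ g setT measurableT (EFin \o (fun z : R => u z * z))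
  (EFin \o (fun z : R => M * (expR z + expR (- z))))) => //.
- by apply/measurable_EFinP; apply: measurable_funM.
- move=> x _ /=; rewrite lee_fin normrM.
  rewrite [leRHS]ger0_norm; last by rewrite mulr_ge0// addr_ge0// expR_ge0.
  by rewrite ler_pM// ler_norm_expR.
- have := integrableZl measurableT M integrable_gauss_expRD.
  by apply: eq_integrable.
Qed.

Lemma integrable_gauss_id : g.-integrable setT (EFin \o (@id R)).
Proof.
have := @integrable_gauss_mul_id (cst 1) 1 (measurable_cst _).
move=> /(_ _)/= H; have : g.-integrable setT (EFin \o (fun z : R => 1 * z)).
  by apply: H => x; rewrite normr1.
by apply: eq_integrable => // x _ /=; rewrite mul1r.
Qed.

Lemma RintegralN_gauss (u : R -> R) : measurable_fun setT u ->
  \int[g]_x u (- x) = \int[g]_x u x.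
Proof.
move=> mu_; rewrite /Rintegral; congr fine.
have mE : measurable_fun setT (EFin \o u) by exact/measurable_EFinP.
rewrite [LHS]integralE [RHS]integralE; congr (_ - _)%E.
  rewrite -[RHS](ge0_integral_gaussN (measurable_funepos mE) (fun x => funepos_ge0 _ x)).
  by apply: eq_integral => x _; rewrite !funeposE.
rewrite -[RHS](ge0_integral_gaussN (measurable_funeneg mE) (fun x => funeneg_ge0 _ x)).
by apply: eq_integral => x _; rewrite !funenegE.
Qed.

Lemma Rintegral_gauss_id : \int[g]_x x = 0 :> R.
Proof.
have := @RintegralN_gauss (@id R) (@measurable_id _ _ _); rewrite /=.
under eq_Rintegral do rewrite -mulN1r.
rewrite (RintegralZl (-1) measurableT integrable_gauss_id); lra.
Qed.

Lemma Rintegral_gauss_cst (c : R) : \int[g]_x c = c.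
Proof.
rewrite Rintegral_cst// -[RHS]mulr1; congr (_ * _).
have gT : g setT = 1%E := probability_setT g.
by rewrite -[RHS]/(fine 1%E) -gT.
Qed.

End gauss_integrable.

(** * Symmetry, semigroup law and association *)

Section ornstein_uhlenbeck.
Context {R : realType}.
Local Notation g := (@normal_prob R 0 1).

(** Nonnegativity opens the Tonelli-type identities for extended-real integrals; boundedness makes
    the integrals finite, so that the identities pass to real integrals. *)
Definition pos_bounded (u : R -> R) : Prop :=
  measurable_fun setT u /\ exists M, forall x, 0 <= u x <= M.

(* Correlation r plays the role of exp(-t) in the Ornstein-Uhlenbeck semigroup. *)
Definition ou (r : R) (u : R -> R) (x : R) : R :=
  \int[g]_z u (r * x + Num.sqrt (1 - r ^+ 2) * z).

Lemma pos_bounded_integrable u : pos_bounded u -> g.-integrable setT (EFin \o u).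
Proof.
move=> [mu_ [M uM]]; apply: (@integrable_gauss_bounded _ u M) => // x.
by have /andP[u0 ?] := uM x; rewrite ger0_norm.
Qed.

Lemma pos_boundedM u v : pos_bounded u -> pos_bounded v ->
  pos_bounded (fun x => u x * v x).
Proof.
move=> [mu_ [M uM]] [mv [N vN]]; split; first exact: measurable_funM.
exists (M * N) => x; have /andP[u0 u1] := uM x; have /andP[v0 v1] := vN x.
by rewrite mulr_ge0//= ler_pM.
Qed.

Lemma pos_bounded_cst (c : R) : 0 <= c -> pos_bounded (cst c).
Proof. by move=> c0; split => //; exists c => x /=; rewrite c0 lexx. Qed.

Lemma pos_bounded_affine u (a b : R) : pos_bounded u ->
  pos_bounded (fun z => u (a + b * z)).
Proof.
move=> [mu_ [M uM]]; split; last by exists M.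
by apply: measurableT_comp => //; apply: measurable_funD => //; exact: measurable_funM.
Qed.

Lemma pos_bounded_integralE u : pos_bounded u ->
  (\int[g]_x (u x)%:E = (\int[g]_x u x)%:E)%E.
Proof.
by move=> bu; rewrite fineK//; apply: integrable_fin_num => //; exact: pos_bounded_integrable.
Qed.

Lemma ouE r u x : pos_bounded u ->
  (\int[g]_z (u (r * x + Num.sqrt (1 - r ^+ 2) * z))%:E = (ou r u x)%:E)%E.
Proof. by move=> bu; rewrite pos_bounded_integralE//; exact: pos_bounded_affine. Qed.

Lemma pos_bounded_ou r u : pos_bounded u -> pos_bounded (ou r u).
Proof.
move=> bu; have [mu_ [M uM]] := bu; split.
  apply/measurable_EFinP.
  have -> : EFin \o ou r u = fun x =>
      (\int[g]_z (u (r * x + Num.sqrt (1 - r ^+ 2) * z))%:E)%E.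
    by apply/funext => x; rewrite ouE.
  apply: (@measurable_fun_fubini_tonelli_F _ _ _ _ R g
    (fun p : R * R => (u (r * p.1 + Num.sqrt (1 - r ^+ 2) * p.2))%:E)).
    apply/measurable_EFinP; apply: measurableT_comp => //.
    by apply: measurable_funD; exact: measurable_funM.
  by move=> p; rewrite lee_fin; have /andP[] := uM (r * p.1 + Num.sqrt (1 - r ^+ 2) * p.2).
exists M => x; apply/andP; split.
  by apply: Rintegral_ge0 => z _; have /andP[] := uM (r * x + Num.sqrt (1 - r ^+ 2) * z).
rewrite -[leRHS]Rintegral_gauss_cst; apply: le_Rintegral => //.
- by apply: pos_bounded_integrable; exact: pos_bounded_affine.
- exact: finite_measure_integrable_cst.
- by move=> z _; have /andP[] := uM (r * x + Num.sqrt (1 - r ^+ 2) * z).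
Qed.

Lemma ou_homo r u : 0 <= r -> pos_bounded u -> {homo u : s t / s <= t} ->
  {homo ou r u : s t / s <= t}.
Proof.
move=> r0 bu hu x y xy; apply: le_Rintegral => //.
- by apply: pos_bounded_integrable; exact: pos_bounded_affine.
- by apply: pos_bounded_integrable; exact: pos_bounded_affine.
- by move=> z _; apply: hu; rewrite lerD2r ler_wpM2l.
Qed.

Lemma integral_mul_ou r u v : pos_bounded u -> pos_bounded v ->
  (\int[g]_x \int[g]_y (u x * v (r * x + Num.sqrt (1 - r ^+ 2) * y)%R)%:E =
   (\int[g]_x (u x * ou r v x))%:E)%E.
Proof.
move=> bu bv; rewrite -pos_bounded_integralE; last first.
  by apply: pos_boundedM => //; exact: pos_bounded_ou.
apply: eq_integral => x _; rewrite EFinM -ouE//.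
rewrite -integralZl//; last first.
  by apply: pos_bounded_integrable; exact: pos_bounded_affine.
Qed.

(** Exchangeability: the reflection with [c = r] and [s = q] swaps [x] and [r x + q y]. *)
Lemma ou_sym r u v : r ^+ 2 <= 1 -> pos_bounded u -> pos_bounded v ->
  \int[g]_x (u x * ou r v x) = \int[g]_x (ou r u x * v x).
Proof.
move=> r1 bu bv; apply: EFin_inj; rewrite -integral_mul_ou//.
under [in RHS]eq_Rintegral do rewrite mulrC.
rewrite -integral_mul_ou//.
set q := Num.sqrt (1 - r ^+ 2).
have rq : r ^+ 2 + q ^+ 2 = 1 by rewrite sqr_sqrtr ?subr_ge0// addrC subrK.
pose F (p : R * R) := (u p.1 * v (r * p.1 + q * p.2))%:E.
have mF : measurable_fun setT F.
  apply/measurable_EFinP; apply: measurable_funM.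
    by apply: measurableT_comp => //; case: bu.
  apply: measurableT_comp; first by case: bv.
  by apply: measurable_funD; exact: measurable_funM.
have F0 p : (0 <= F p)%E.
  rewrite lee_fin; apply: mulr_ge0.
    by have [_ [M]] := bu => /(_ p.1)/andP[].
  by have [_ [M]] := bv => /(_ (r * p.1 + q * p.2))/andP[].
rewrite -(gauss_reflection rq mF F0).
apply: eq_integral => x _; apply: eq_integral => y _; rewrite /F /= mulrC.
congr (_ * _)%:E; congr v.
by rewrite -[RHS]mul1r -rq; ring.
Qed.

Lemma ou_cst r (c : R) x : ou r (cst c) x = c.
Proof. by rewrite /ou Rintegral_gauss_cst. Qed.

Lemma Rintegral_ou r u : r ^+ 2 <= 1 -> pos_bounded u ->
  \int[g]_x ou r u x = \int[g]_x u x.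
Proof.
move=> r1 bu; have := ou_sym r1 bu (pos_bounded_cst ler01).
under eq_Rintegral do rewrite ou_cst mulr1.
by move=> ->; apply: eq_Rintegral => x _; rewrite mulr1.
Qed.

Lemma ou0 u x : ou 0 u x = \int[g]_z u z.
Proof.
by apply: eq_Rintegral => z _; rewrite expr0n/= subr0 sqrtr1 mul0r add0r mul1r.
Qed.

(** The two noises are independent and add up to variance
    [s^2 (1 - r^2) + (1 - s^2) = 1 - (r s)^2]. *)
Lemma ou_comp r s u x : r ^+ 2 <= 1 -> s ^+ 2 <= 1 -> pos_bounded u ->
  ou r (ou s u) x = ou (r * s) u x.
Proof.
move=> r1 s1 bu; apply: EFin_inj; rewrite -!ouE//; last exact: pos_bounded_ou.
have [mu_ [M uM]] := bu.
set qr := Num.sqrt (1 - r ^+ 2); set qs := Num.sqrt (1 - s ^+ 2).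
have mF : measurable_fun setT (fun t => (u (r * s * x + t))%:E).
  by apply/measurable_EFinP; apply: measurableT_comp => //; exact: measurable_funD.
have F0 t : (0 <= (u (r * s * x + t))%:E)%E.
  by rewrite lee_fin; have /andP[] := uM (r * s * x + t).
transitivity (\int[g]_z \int[g]_y (u (r * s * x + (s * qr * z + qs * y)))%:E)%E.
  apply: eq_integral => z _; rewrite -ouE//; apply: eq_integral => y _.
  by congr (u _)%:E; rewrite /qs; ring.
rewrite (gauss_add (s * qr) qs mF F0); apply: eq_integral => z _.
congr (u (_ + Num.sqrt _ * _))%:E.
by rewrite exprMn !sqr_sqrtr ?subr_ge0//; ring.
Qed.

(* Integrate (u z - u y) (v z - v y) >= 0 over the exchangeable pair (y, z). *)
Lemma ou_association r u v : r ^+ 2 <= 1 ->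
  pos_bounded u -> pos_bounded v ->
  {homo u : s t / s <= t} -> {homo v : s t / s <= t} ->
  \int[g]_x (u x * ou r v x) <= \int[g]_x (u x * v x).
Proof.
move=> r1 bu bv hu hv.
have buv := pos_boundedM bu bv.
have H y : u y * ou r v y + ou r u y * v y <= ou r (fun z => u z * v z) y + u y * v y.
  pose L z := r * y + Num.sqrt (1 - r ^+ 2) * z.
  have iu : g.-integrable setT (EFin \o (u \o L)).
    by apply: pos_bounded_integrable; exact: pos_bounded_affine.
  have iv : g.-integrable setT (EFin \o (v \o L)).
    by apply: pos_bounded_integrable; exact: pos_bounded_affine.
  have iuv : g.-integrable setT (EFin \o (fun z => u (L z) * v (L z))).
    by apply: pos_bounded_integrable; exact: (pos_bounded_affine _ _ buv).
  have i1 : g.-integrable setT (EFin \o (fun z => u y * v (L z))).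
    by have := integrableZl measurableT (u y) iv; apply: eq_integrable.
  have i2 : g.-integrable setT (EFin \o (fun z => u (L z) * v y)).
    have := integrableZl measurableT (v y) iu; apply: eq_integrable => // z _.
    by rewrite /= -EFinM mulrC.
  have i3 : g.-integrable setT (EFin \o (fun z : R => u y * v y)).
    exact: finite_measure_integrable_cst.
  rewrite /ou -/(L _) -(RintegralZl (u y) measurableT iv).
  rewrite -(RintegralZr (v y) measurableT iu) -(RintegralD measurableT i1 i2).
  rewrite -[X in _ + X]Rintegral_gauss_cst -(RintegralD measurableT iuv i3).
  apply: le_Rintegral => //.
  - by have := integrableD measurableT i1 i2; apply: eq_integrable.
  - by have := integrableD measurableT iuv i3; apply: eq_integrable.
  - move=> z _; have [yz|zy] := leP y (L z).
      by have := hu _ _ yz; have := hv _ _ yz; nra.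
    by have := hu _ _ (ltW zy); have := hv _ _ (ltW zy); nra.
have j1 := pos_bounded_integrable (pos_boundedM bu (pos_bounded_ou r bv)).
have j2 := pos_bounded_integrable (pos_boundedM (pos_bounded_ou r bu) bv).
have j3 := pos_bounded_integrable (pos_bounded_ou r buv).
have j4 := pos_bounded_integrable buv.
have := @le_Rintegral _ _ _ g setT
  (fun y => u y * ou r v y + ou r u y * v y)
  (fun y => ou r (fun z => u z * v z) y + u y * v y) measurableT.
rewrite (RintegralD measurableT j1 j2) (RintegralD measurableT j3 j4).
rewrite -ou_sym// Rintegral_ou// => K.
suff : \int[g]_x (u x * ou r v x) + \int[g]_x (u x * ou r v x) <=
  \int[g]_x (u x * v x) + \int[g]_x (u x * v x) by lra.
apply: K => //.
- by have := integrableD measurableT j1 j2; apply: eq_integrable.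
- by have := integrableD measurableT j3 j4; apply: eq_integrable.
Qed.

(** At correlation 0 the exchangeable pair is independent and [ou 0 v] is the mean of [v]. *)
Lemma gauss_association u v :
  pos_bounded u -> pos_bounded v ->
  {homo u : s t / s <= t} -> {homo v : s t / s <= t} ->
  (\int[g]_x u x) * (\int[g]_x v x) <= \int[g]_x (u x * v x).
Proof.
move=> bu bv hu hv; have := @ou_association 0 u v _ bu bv hu hv.
under eq_Rintegral do rewrite ou0.
rewrite RintegralZr//; last exact: pos_bounded_integrable.
by apply; rewrite expr0n/= ler01.
Qed.

End ornstein_uhlenbeck.

(** * Slope of the smoothed function *)

Section slope.
Context {R : realType}.
Local Notation mu := (@lebesgue_measure R).
Local Notation g := (@normal_prob R 0 1).
Local Notation phi := (@normal_pdf R 0 1).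

(** The part of the first moment of [u] carried by [|z| <= T], folded onto the positive half-line.
    For nondecreasing [u] the folded integrand is nonnegative, so it can serve as a pointwise lower
    bound. *)
Definition odd_trunc (u : R -> R) (T z : R) : R :=
  (u z - u (- z)) * z * \1_(`]0, T]%classic) z.

Lemma odd_truncE u T z :
  odd_trunc u T z = if (0 < z <= T) then (u z - u (- z)) * z else 0.
Proof.
rewrite /odd_trunc indicE; case: ifPn => h.
  by rewrite mem_set ?mulr1//= in_itv.
by rewrite memNset ?mulr0//= in_itv; exact/negP.
Qed.

(** The base point [m] is kept apart from the mean [d] of the kernel: two centres [m + d] and
    [m - d] then see the same values [u (m + y)] under kernels that mirror each other. *)
Lemma ge0_integral_gauss_affine (u : R -> R) (m d q : R) : 0 < q ->
  measurable_fun setT u -> (forall x, 0 <= u x) ->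
  (\int[g]_z (u (m + d + q * z))%:E =
   \int[mu]_y (u (m + y) * (phi ((y - d) / q) / q))%:E)%E.
Proof.
move=> q0 mu_ u0.
have maff (a b : R) : measurable_fun setT (fun z : R => b * z + a).
  by apply: measurable_funD => //; exact: measurable_funM.
have mU : measurable_fun setT (fun z : R => u (m + d + q * z)).
  apply: measurableT_comp => //; have := maff (m + d) q.
  by congr (measurable_fun _ _); apply/funext => z; rewrite addrC.
rewrite ge0_integral_normal_prob; last 2 first.
- exact/measurable_EFinP.
- by move=> x; rewrite lee_fin.
have qV : q^-1 != 0 by rewrite invr_eq0 gt_eqF.
have mP : measurable_fun setT (fun z : R => ((u (m + d + q * z))%:E * (phi z)%:E)%E).
  by apply: emeasurable_funM; [exact/measurable_EFinP|exact: (@measurable_normal_pdf01 _ _ _ id)].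
rewrite [LHS](ge0_integral_affine (- d / q) qV mP); last first.
  by move=> x; rewrite -EFinM lee_fin mulr_ge0// normal_pdf_ge0.
rewrite -ge0_integralZl//.
- apply: eq_integral => y _; rewrite -!EFinM; congr EFin.
  rewrite gtr0_norm ?invr_gt0// mulrC -mulrA; congr (u _ * (phi _ / _)).
    by field; lra.
  by field; lra.
- exact: (measurableT_comp mP (measurable_affine _ _)).
- by move=> x _; rewrite -EFinM lee_fin mulr_ge0// normal_pdf_ge0.
Qed.

(* The exponent identity is [(y -+ d)^2 = y^2 + d^2 -+ 2 y d]; what is left is
   [exp t - exp (- t) >= t] at [t = y d / q^2]. *)
Lemma gauss_kernel_gap (q d e w T : R) : 0 < q -> 3 / 4 <= q ^+ 2 <= 1 ->
  0 <= d <= 1 / 2 -> 0 <= e <= 1 / 2 -> 0 <= w <= T ->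
  (1 - q ^+ 2) * T ^+ 2 <= 1 / 4 -> e * T <= 1 / 2 ->
  expR (- 2) * d * w * phi w <=
  phi ((w + e - d) / q) / q - phi ((- (w + e) - d) / q) / q.
Proof.
move=> q0 /andP[q1 q2] /andP[d0 d1] /andP[e0 e1] /andP[w0 wT] qT eT.
have q20 : 0 < q ^+ 2 by lra.
have qn0 : q != 0 by rewrite gt_eqF.
set y := w + e; pose t := y * d / q ^+ 2; pose X := (y ^+ 2 + d ^+ 2) / (2 * q ^+ 2).
have y0 : w <= y by rewrite /y; lra.
have -> : phi ((y - d) / q) = normal_peak 1 * (expR (- X) * expR t).
  by rewrite normal_pdf01E -expRD; congr (_ * expR _); rewrite /X /t; field.
have -> : phi ((- y - d) / q) = normal_peak 1 * (expR (- X) * expR (- t)).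
  by rewrite normal_pdf01E -expRD; congr (_ * expR _); rewrite /X /t; field.
have t0 : w * d <= t.
  rewrite /t ler_pdivlMr//; apply: (@le_trans _ _ (w * d)).
    by rewrite ler_piMr// mulr_ge0.
  exact: ler_wpM2r.
have wd0 : 0 <= w * d by rewrite mulr_ge0.
have E1 : w * d <= expR t - expR (- t).
  have := expR_ge1Dx t.
  have : expR (- t) <= 1 by rewrite -[leRHS]expR0 ler_expR; lra.
  lra.
(* After clearing [2 q^2], the excess over [w^2 / 2] consists of [(1 - q^2) w^2], [2 e w], [e^2] and
   [d^2], at most [7 / 4] in total, while [4 q^2 >= 3]: this is the origin of [exp (-2)]. *)
have E2 : expR (- 2) * expR (- w ^+ 2 / 2) <= expR (- X).
  rewrite -expRD ler_expR; suff : X <= w ^+ 2 / 2 + 2 by lra.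
  rewrite /X ler_pdivrMr ?mulr_gt0//.
  have : (1 - q ^+ 2) * w ^+ 2 <= 1 / 4.
    apply: le_trans qT; apply: ler_wpM2l; first lra.
    by rewrite ler_sqr ?nnegrE//; exact: le_trans wT.
  have : e * w <= 1 / 2 by apply: le_trans eT; exact: ler_wpM2l.
  have : e ^+ 2 <= 1 / 4 by nra.
  have : d ^+ 2 <= 1 / 4 by nra.
  rewrite /y; nra.
rewrite normal_pdf01E.
have P0 : 0 < normal_peak 1 :> R by rewrite normal_peak_gt0// oner_eq0.
rewrite -mulrBl -!mulrBr.
have q11 : 1 <= q^-1 by rewrite invf_ge1//; nra.
have M : expR (- 2) * expR (- w ^+ 2 / 2) * (w * d) <=
   expR (- X) * (expR t - expR (- t)).
  by rewrite ler_pM// mulr_ge0// expR_ge0.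
have M0 : 0 <= expR (- 2) * expR (- w ^+ 2 / 2) * (w * d).
  by rewrite !mulr_ge0// expR_ge0.
rewrite [leLHS](_ : _ = normal_peak 1 * (expR (- 2) * expR (- w ^+ 2 / 2) * (w * d))); last by ring.
apply: (@le_trans _ _ (normal_peak 1 * (expR (- X) * (expR t - expR (- t))))).
  by rewrite ler_pM2l.
by rewrite ler_peMr// mulr_ge0// ?(ltW P0)// (le_trans M0).
Qed.

End slope.

(** * From the kernel comparison to increments of [ou r u] *)

Section slope.
Context {R : realType}.
Local Notation mu := (@lebesgue_measure R).
Local Notation g := (@normal_prob R 0 1).
Local Notation phi := (@normal_pdf R 0 1).

Lemma odd_trunc_ge0 (u : R -> R) T z : {homo u : s t / s <= t} -> 0 <= odd_trunc u T z.
Proof.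
move=> hu; rewrite odd_truncE; case: ifPn => // /andP[z0 _].
by rewrite mulr_ge0 ?(ltW z0)// subr_ge0; apply: hu; lra.
Qed.

Lemma measurable_odd_trunc (u : R -> R) T : measurable_fun setT u ->
  measurable_fun setT (odd_trunc u T).
Proof.
move=> mu_; apply: measurable_funM; last exact: measurable_indic.
apply: measurable_funM => //; apply: measurable_funB => //.
exact: measurableT_comp.
Qed.

Lemma integrable_odd_trunc (u : R -> R) T : measurable_fun setT u ->
  (forall x, 0 <= u x <= 1) -> g.-integrable setT (EFin \o odd_trunc u T).
Proof.
move=> mu_ u01.
have -> : odd_trunc u T = fun z => ((u z - u (- z)) * \1_(`]0, T]%classic) z) * z.
  by apply/funext => z; rewrite /odd_trunc mulrAC.
apply: (@integrable_gauss_mul_id _ _ 1).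
  apply: measurable_funM; last exact: measurable_indic.
  apply: measurable_funB => //; exact: measurableT_comp.
move=> x; have /andP[a b] := u01 x; have /andP[c d] := u01 (- x).
rewrite normrM mulr_ile1//; first by rewrite ler_norml; apply/andP; split; lra.
by rewrite indicE; case: (_ \in _); rewrite ?normr1 ?normr0.
Qed.

(** A rearrangement inequality: the exchange gains [(u (m + y) - u (m - y)) (A y - A (- y))], whose
    factors have the sign of [y]. For [w = y - |m| > 0] one has [m - y <= - w] and [w <= m + y], so
    the first factor is at least [u w - u (- w)]; the shift by [|m|] thus yields a bound centred at
    0 whatever [m] is. *)
Lemma kernel_exchange (q d m T y : R) (u : R -> R) :
  0 < q -> 3 / 4 <= q ^+ 2 <= 1 -> 0 <= d <= 1 / 2 -> `|m| <= 1 / 2 ->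
  (1 - q ^+ 2) * T ^+ 2 <= 1 / 4 -> `|m| * T <= 1 / 2 ->
  {homo u : s t / s <= t} ->
  let A y := phi ((y - d) / q) / q in
  u (m + y) * A (- y) + u (m - y) * A y +
    expR (- 2) * d * odd_trunc u T (y - `|m|) * phi (y - `|m|) <=
  u (m + y) * A y + u (m - y) * A (- y).
Proof.
move=> q0 q1 /andP[d0 d1] m1 qT mT hu; set e := `|m|.
cbv beta zeta; pose A z := phi ((z - d) / q) / q; rewrite -/(A y) -/(A (- y)).
have e0 : 0 <= e by exact: normr_ge0.
have AA z : 0 <= z -> A (- z) <= A z.
  move=> z0; rewrite ler_pM2r ?invr_gt0// !normal_pdf01E ler_pM2l ?normal_peak_gt0 ?oner_eq0//.
  rewrite ler_expR ler_pM2r ?invr_gt0// lerN2 !expr_div_n ler_pM2r ?invr_gt0 ?exprn_gt0//.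
  by nra.
have uu z : 0 <= z -> u (m - z) <= u (m + z) by move=> z0; apply: hu; lra.
set D := expR (- 2) * d * _ * _.
suff : D <= (u (m + y) - u (m - y)) * (A y - A (- y)) by lra.
have [y0|y0] := leP 0 y; last first.
  have -> : D = 0.
    by rewrite /D odd_truncE; case: ifPn; [lra|rewrite mulr0 mul0r].
  have := AA (- y); have := uu (- y); rewrite opprK => P Q.
  by rewrite mulr_le0// subr_le0; [apply: P|apply: Q]; lra.
rewrite /D odd_truncE; case: ifPn => [/andP[w0 wT]|_]; last first.
  by rewrite mulr0 mul0r mulr_ge0 ?subr_ge0 ?AA ?uu.
have me : - e <= m <= e by rewrite -ler_norml.
have u1 : u (y - e) <= u (m + y) by apply: hu; lra.
have u2 : u (m - y) <= u (- (y - e)) by apply: hu; lra.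
have u3 : u (- (y - e)) <= u (y - e) by apply: hu; lra.
have gap : expR (- 2) * d * (y - e) * phi (y - e) <= A y - A (- y).
  have := @gauss_kernel_gap R q d e (y - e) T q0 q1.
  rewrite subrK; apply => //; apply/andP; split => //; exact: ltW.
rewrite [leLHS](_ : _ = (u (y - e) - u (- (y - e))) *
  (expR (- 2) * d * (y - e) * phi (y - e))); last by ring.
apply: ler_pM => //.
- by rewrite subr_ge0.
- apply: mulr_ge0; last exact: normal_pdf_ge0.
  by apply: mulr_ge0; [apply: mulr_ge0 => //; exact: expR_ge0|exact: ltW].
- lra.
Qed.

(** Integrate [kernel_exchange] with [m] the midpoint of [r x'] and [r x], and [d] half their
    distance. The bound on [r] gives [q^2 >= 3 / 4], that on [r S] controls [m] and [d], that on
    [r T] controls [(1 - q^2) T^2], and that on [r S T] controls [|m| T]. The factor [1 / 4] is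
    [1 / 2] from [d] and [1 / 2] because folding counts every increment twice. *)
Lemma ou_slope (r S T : R) (u : R -> R) (x x' : R) :
  0 <= r <= 1 / 2 -> r * S <= 1 / 2 -> r * T <= 1 / 2 -> r * S * T <= 1 / 2 ->
  0 <= T -> - S <= x' -> x' <= x -> x <= S ->
  measurable_fun setT u -> (forall x, 0 <= u x <= 1) -> {homo u : s t / s <= t} ->
  expR (- 2) * r / 4 * (\int[g]_z odd_trunc u T z) * (x - x') <= ou r u x - ou r u x'.
Proof.
move=> /andP[r0 r1] rS rT rST T0 Sx xx xS mu_ u01 hu.
have bu : pos_bounded u by split => //; exists 1.
have u0 y : 0 <= u y by have /andP[] := u01 y.
have r2 : r ^+ 2 <= 1 / 4 by nra.
have rT2 : (r * T) ^+ 2 <= 1 / 4.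
  by have := mulr_ge0 r0 T0; nra.
have r20 : 0 <= r ^+ 2 by exact: sqr_ge0.
pose q := Num.sqrt (1 - r ^+ 2).
have q2 : q ^+ 2 = 1 - r ^+ 2 by rewrite sqr_sqrtr//; nra.
have q0 : 0 < q by rewrite sqrtr_gt0; nra.
pose m := r * (x + x') / 2; pose d := r * (x - x') / 2; pose e := `|m|.
have d0 : 0 <= d by rewrite /d; nra.
have d1 : d <= 1 / 2 by rewrite /d; nra.
have e0 : 0 <= e by exact: normr_ge0.
have eS : e <= r * S by rewrite /e /m ler_norml; apply/andP; split; nra.
have e1 : e <= 1 / 2 by lra.
have eT : e * T <= 1 / 2 by nra.
pose A y := phi ((y - d) / q) / q.
pose A' y := phi ((- y - d) / q) / q.
have A0 y : 0 <= A y by rewrite divr_ge0 ?normal_pdf_ge0// ltW.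
have A'0 y : 0 <= A' y by rewrite divr_ge0 ?normal_pdf_ge0// ltW.
have A'E y : A' y = phi ((y - - d) / q) / q.
  by congr (_ / _); rewrite !normal_pdf01E; congr (_ * expR _); field; lra.
have A'N y : A' (- y) = A y by rewrite /A' opprK.
have AN y : A (- y) = A' y by [].
have mA : measurable_fun setT A.
  apply: measurable_funM => //; apply: measurableT_comp; first exact: measurable_normal_pdf.
  by apply: measurable_funM => //; exact: measurable_funB.
have mA' : measurable_fun setT A'.
  apply: measurable_funM => //; apply: measurableT_comp; first exact: measurable_normal_pdf.
  by apply: measurable_funM => //; exact: measurable_funB.
have muD : measurable_fun setT (fun y : R => u (m + y)).
  by apply: measurableT_comp => //; exact: measurable_funD.
have muB : measurable_fun setT (fun y : R => u (m - y)).
  by apply: measurableT_comp => //; exact: measurable_funB.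
have mDA : measurable_fun setT (fun y : R => (u (m + y) * A y)%:E).
  by apply/measurable_EFinP; exact: measurable_funM.
have mDA' : measurable_fun setT (fun y : R => (u (m + y) * A' y)%:E).
  by apply/measurable_EFinP; exact: measurable_funM.
have mBA : measurable_fun setT (fun y : R => (u (m - y) * A y)%:E).
  by apply/measurable_EFinP; exact: measurable_funM.
have mBA' : measurable_fun setT (fun y : R => (u (m - y) * A' y)%:E).
  by apply/measurable_EFinP; exact: measurable_funM.
have c1 y : (0 <= (u (m + y) * A y)%:E)%E by rewrite lee_fin mulr_ge0.
have c2 y : (0 <= (u (m + y) * A' y)%:E)%E by rewrite lee_fin mulr_ge0.
have c3 y : (0 <= (u (m - y) * A y)%:E)%E by rewrite lee_fin mulr_ge0.
have c4 y : (0 <= (u (m - y) * A' y)%:E)%E by rewrite lee_fin mulr_ge0.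
(* Each value of [ou r u] is written twice, over [y] and over [- y], to match the four products in
   [kernel_exchange]. *)
have h1 : ((ou r u x)%:E = \int[mu]_y (u (m + y) * A y)%:E)%E.
  rewrite -(ouE _ _ bu) -(ge0_integral_gauss_affine m d q0 mu_ u0).
  by apply: eq_integral => z _; congr (u (_ + _))%:E; rewrite /m /d; field.
have h2 : ((ou r u x')%:E = \int[mu]_y (u (m + y) * A' y)%:E)%E.
  transitivity (\int[mu]_y (u (m + y) * (phi ((y - - d) / q) / q))%:E)%E.
    rewrite -(ouE _ _ bu) -(ge0_integral_gauss_affine m (- d) q0 mu_ u0).
    by apply: eq_integral => z _; congr (u (_ + _))%:E; rewrite /m /d; field.
  by apply: eq_integral => y _; rewrite A'E.
have h1' : ((ou r u x)%:E = \int[mu]_y (u (m - y) * A' y)%:E)%E.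
  rewrite h1 -(ge0_integralN mDA c1).
  by apply: eq_integral => y _; rewrite AN.
have h2' : ((ou r u x')%:E = \int[mu]_y (u (m - y) * A y)%:E)%E.
  rewrite h2 -(ge0_integralN mDA' c2).
  by apply: eq_integral => y _; rewrite A'N.
pose K := expR (- 2) * d.
have K0 : 0 <= K by rewrite mulr_ge0// expR_ge0.
pose D w := K * odd_trunc u T w * phi w.
have D0 w : 0 <= D w.
  apply: mulr_ge0; last exact: normal_pdf_ge0.
  by apply: mulr_ge0 => //; exact: odd_trunc_ge0.
have mD : measurable_fun setT (fun w : R => (D w)%:E).
  apply/measurable_EFinP; apply: measurable_funM; last exact: measurable_normal_pdf.
  by apply: measurable_funM => //; exact: measurable_odd_trunc.
have mDs : measurable_fun setT (fun y : R => (D (1 * y + - e))%:E).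
  exact: (measurableT_comp mD (measurable_affine 1 (- e))).
(* Translation invariance of Lebesgue measure removes the shift by [e], so the bound no longer
   depends on the position of [m]. *)
have hD : ((K * \int[g]_z odd_trunc u T z)%:E = \int[mu]_y (D (1 * y + - e))%:E)%E.
  have := @ge0_integral_affine R 1 (- e) (fun w : R => (D w)%:E) (oner_neq0 _) mD.
  rewrite normr1 mul1e => <-; last by move=> w; rewrite lee_fin.
  have mo : measurable_fun setT (fun z => (odd_trunc u T z)%:E).
    by apply/measurable_EFinP; exact: measurable_odd_trunc.
  have io := integrable_odd_trunc T mu_ u01.
  rewrite EFinM /Rintegral fineK; last exact: integrable_fin_num.
  rewrite (ge0_integral_normal_prob mo); last by move=> w; rewrite lee_fin odd_trunc_ge0.
  rewrite -ge0_integralZl//.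
  - by apply: eq_integral => w _; rewrite -!EFinM mulrA.
  - by apply: emeasurable_funM => //; exact: (@measurable_normal_pdf01 _ _ _ id).
  - by move=> w _; rewrite -EFinM lee_fin mulr_ge0 ?odd_trunc_ge0 ?normal_pdf_ge0.
have key y : u (m + y) * A' y + u (m - y) * A y + D (1 * y + - e) <=
    u (m + y) * A y + u (m - y) * A' y.
  rewrite mul1r; apply: (kernel_exchange y q0) => //.
  - by apply/andP; split; lra.
  - exact/andP.
  - by rewrite q2 subKr -exprMn.

have : (((ou r u x' + ou r u x') + K * \int[g]_z odd_trunc u T z)%:E <=
    (ou r u x + ou r u x)%:E)%E.
  rewrite !EFinD {1}h2 h2' {1}h1 h1' hD.
  have c5 y : (0 <= (D (1 * y + - e))%:E)%E by rewrite lee_fin.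
  rewrite -(ge0_integralD mu measurableT (fun y _ => c2 y) mDA' (fun y _ => c3 y) mBA).
  rewrite -(ge0_integralD mu measurableT (fun y _ => c1 y) mDA (fun y _ => c4 y) mBA').
  rewrite -(ge0_integralD mu measurableT (fun y _ => adde_ge0 (c2 y) (c3 y))
    (emeasurable_funD mDA' mBA) (fun y _ => c5 y) mDs).
  apply: ge0_le_integral => //.
  - by move=> y _; apply: adde_ge0 => //; exact: adde_ge0.
  - by apply: emeasurable_funD => //; exact: emeasurable_funD.
  - exact: emeasurable_funD.
  - by move=> y _; rewrite -!EFinD lee_fin; exact: key.
rewrite lee_fin /K /d => H.
set B := \int[g]_z _ in H *.
have -> : expR (-2) * r / 4 * B * (x - x') = (expR (-2) * (r * (x - x') / 2) * B) / 2 by field.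
lra.
Qed.

End slope.

(** * The inequality for a correlated pair *)

Section one_dimensional.
Context {R : realType}.
Local Notation g := (@normal_prob R 0 1).

(** A Chernoff bound for [E[Z; Z > T]]: the mean of [exp ((T + 1) Z - T^2)], of order
    [exp (T - T^2 / 2)]. *)
Definition exp_tail (T : R) : R := expR ((T + 1) ^+ 2 / 2 - T ^+ 2).

(** The exponent is [z + T (z - T)], at least [z] beyond [T]. *)
Lemma ler_id_exp_tail (T z : R) : 0 <= T -> T < z -> z <= expR ((T + 1) * z - T ^+ 2).
Proof.
move=> T0 Tz; apply: (@le_trans _ _ (expR z)).
  by have := expR_ge1Dx z; lra.
by rewrite ler_expR; nra.
Qed.

Lemma integrable_exp_tail (T : R) :
  g.-integrable setT (EFin \o (fun z => expR ((T + 1) * z - T ^+ 2))).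
Proof.
have := integrableZl measurableT (expR (- T ^+ 2)) (integrable_gauss_expR (T + 1)).
by apply: eq_integrable => // z _; rewrite /= -EFinM -expRD addrC.
Qed.

Lemma Rintegral_exp_tail (T : R) : \int[g]_z expR ((T + 1) * z - T ^+ 2) = exp_tail T.
Proof.
transitivity (\int[g]_z (expR (- T ^+ 2) * expR ((T + 1) * z))).
  by apply: eq_Rintegral => z _; rewrite -expRD addrC.
rewrite (RintegralZl _ measurableT (integrable_gauss_expR (T + 1))).
by rewrite /Rintegral integral_gauss_expR /= -expRD addrC.
Qed.

(** Symmetry of [g] makes twice the moment equal to the mean of the even function
    [(u z - u (- z)) z]. Inside [|z| <= T] this is [odd_trunc] at [z] or at [- z]; outside it is at
    most [|z|], which the exponentials dominate. Both sides are therefore compared doubled. *)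
Lemma moment_le_odd_trunc (T : R) (u : R -> R) : 0 <= T ->
  measurable_fun setT u -> (forall x, 0 <= u x <= 1) -> {homo u : s t / s <= t} ->
  \int[g]_z (u z * z) <= \int[g]_z odd_trunc u T z + exp_tail T.
Proof.
move=> T0 mu_ u01 hu.
have uM x : `|u x| <= 1 by have /andP[a b] := u01 x; rewrite ger0_norm.
have mu' : measurable_fun setT (fun x : R => u (- x)) by exact: measurableT_comp.
have i1 := integrable_gauss_mul_id mu_ uM.
have i2 := integrable_gauss_mul_id mu' (fun x => uM (- x)).
have i3 := integrable_odd_trunc T mu_ u01.
have mo := measurable_odd_trunc T mu_.
have mo' : measurable_fun setT (fun z : R => odd_trunc u T (- z)) by exact: measurableT_comp.
have i3' : g.-integrable setT (EFin \o (fun z => odd_trunc u T (- z))).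
  have -> : (fun z => odd_trunc u T (- z)) =
    fun z => (- (u (- z) - u z) * \1_(`]0, T]%classic) (- z)) * z.
    by apply/funext => z; rewrite /odd_trunc opprK; ring.
  apply: (@integrable_gauss_mul_id _ _ 1).
    apply: measurable_funM; last first.
      by apply: measurableT_comp => //; exact: measurable_indic.
    by apply: measurableT_comp => //; exact: measurable_funB.
  move=> x; have /andP[a b] := u01 x; have /andP[c d] := u01 (- x).
  rewrite normrM mulr_ile1//; first by rewrite ler_norml; apply/andP; split; lra.
  by rewrite indicE; case: (_ \in _); rewrite ?normr1 ?normr0.
have i4 := integrable_exp_tail T.
have mt : measurable_fun setT (fun z : R => expR ((T + 1) * z - T ^+ 2)).
  by apply: measurableT_comp => //; apply: measurable_funB => //; exact: measurable_funM.
have i4' : g.-integrable setT (EFin \o (fun z => expR ((T + 1) * - z - T ^+ 2))).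
  have := integrableZl measurableT (expR (- T ^+ 2)) (integrable_gauss_expR (- (T + 1))).
  by apply: eq_integrable => // z _; rewrite /= -EFinM -expRD addrC mulNr mulrN.
have e1 : \int[g]_z (u (- z) * z) = - \int[g]_z (u z * z).
  rewrite -(RintegralN_gauss (u := fun z => u z * z)); last exact: measurable_funM.
  transitivity (\int[g]_z (-1 * (u (- z) * - z))).
    by apply: eq_Rintegral => z _; rewrite mulrN mulN1r opprK.
  rewrite RintegralZl// ?mulN1r//.
  have := integrableZl measurableT (-1) i2; apply: eq_integrable => // z _.
  by rewrite /= -EFinM mulrN mulN1r.
have K := @le_Rintegral _ _ _ g setT (fun z => u z * z - u (- z) * z)
  (fun z => (odd_trunc u T z + odd_trunc u T (- z)) +
    (expR ((T + 1) * z - T ^+ 2) + expR ((T + 1) * - z - T ^+ 2))) measurableT.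
have j3 : g.-integrable setT (EFin \o (fun z => odd_trunc u T z + odd_trunc u T (- z))).
  by have := integrableD measurableT i3 i3'; apply: eq_integrable.
have j4 : g.-integrable setT (EFin \o (fun z =>
   expR ((T + 1) * z - T ^+ 2) + expR ((T + 1) * - z - T ^+ 2))).
  by have := integrableD measurableT i4 i4'; apply: eq_integrable.
move: K; rewrite (RintegralB measurableT i1 i2) e1.
rewrite (RintegralD measurableT j3 j4) (RintegralD measurableT i3 i3')
  (RintegralD measurableT i4 i4').
rewrite (RintegralN_gauss mo) (RintegralN_gauss mt) Rintegral_exp_tail => K.
suff : \int[g]_z (u z * z) + \int[g]_z (u z * z) <=
  \int[g]_z odd_trunc u T z + \int[g]_z odd_trunc u T z + (exp_tail T + exp_tail T) by lra.
rewrite -[X in _ + X <= _]opprK; apply: K.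
- by have := integrableB measurableT i1 i2; apply: eq_integrable.
- by have := integrableD measurableT j3 j4; apply: eq_integrable.
move=> z _.
have pos t : 0 <= t -> u t * t - u (- t) * t <= odd_trunc u T t + expR ((T + 1) * t - T ^+ 2).
  move=> t0; rewrite odd_truncE; case: ifPn => [_|].
    by have := expR_ge0 ((T + 1) * t - T ^+ 2); lra.
  rewrite negb_and -leNgt -ltNge => /orP[tl|tT].
    have -> : t = 0 by lra.
    by rewrite !mulr0 subr0 !add0r expR_ge0.
  have := ler_id_exp_tail T0 tT.
  have := u01 t; have := u01 (- t); nra.
have x1 := expR_ge0 ((T + 1) * z - T ^+ 2).
have x2 := expR_ge0 ((T + 1) * - z - T ^+ 2).
have x3 := odd_trunc_ge0 T z hu.
have x4 := odd_trunc_ge0 T (- z) hu.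
have [z0|z0] := leP 0 z; first by have := pos z z0; lra.
have := pos (- z); rewrite opprK; lra.
Qed.

Lemma exists_cutoff (b : R) : 0 < b -> b <= 1 ->
  exists T, [/\ 1 <= T, exp_tail T <= b / 2 & T <= 4 * Num.sqrt (ln (expR 1 / b ^+ 2))].
Proof.
move=> b0 b1.
have l2 : 0 <= ln (2 / b) by rewrite ln_ge0// ler_pdivlMr//; lra.
(* The exponent of [exp_tail T] is [T - T^2 / 2 + 1 / 2]. Since [T <= T^2 / 4 + 1], it is at most
   [3 / 2 - T^2 / 4], and this choice makes the latter equal to [- ln (2 / b)]. *)
pose T2 := 6 + 4 * ln (2 / b); pose T := Num.sqrt T2.
have T20 : 6 <= T2 by rewrite /T2; lra.
have TT : T ^+ 2 = T2 by rewrite sqr_sqrtr//; lra.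
exists T; split.
- by rewrite -[leLHS]sqrtr1 ler_sqrt//; lra.
- rewrite -[leRHS]lnK ?posrE ?divr_gt0// ler_expR.
  have -> : ln (b / 2) = - ln (2 / b) by rewrite -lnV ?posrE ?divr_gt0// invf_div.
  have := sqr_ge0 (T / 2 - 1); rewrite sqrrD sqrrN expr_div_n TT /T2.
  have -> : (T + 1) ^+ 2 / 2 - T2 = T - T2 / 2 + 1 / 2.
    by rewrite sqrrD TT; field.
  rewrite /T2; lra.
- have L0 : 0 <= ln (1 / b) by rewrite ln_ge0// ler_pdivlMr//; lra.
  have E1 : ln (2 / b) = ln 2 + ln (1 / b).
    by rewrite -lnM ?posrE ?divr_gt0//; congr ln; field; lra.
  have E2 : ln (expR 1 / b ^+ 2) = 1 + ln (1 / b) + ln (1 / b).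
    rewrite -{2}(expRK 1) -!lnM ?posrE ?mulr_gt0 ?invr_gt0 ?expR_gt0//.
    by congr ln; field; lra.
  have ln2 : ln 2 <= 1 :> R.
    by rewrite -[leRHS]expRK ler_ln ?posrE ?expR_gt0//; have := expR_ge1Dx (1 : R); lra.
  have E4 X : 4 * Num.sqrt X = Num.sqrt (16 * X) :> R.
    rewrite sqrtrM// (_ : 16 = 4 ^+ 2 :> R); last by ring.
    by rewrite sqrtr_sqr ger0_norm.
  by rewrite E4; apply: ler_wsqrtr; rewrite /T2 E1 E2; lra.
Qed.

(** Monotonicity gives [u z * z >= u 0 * z] for both signs of [z], and the right side has mean 0. *)
Lemma moment_ge0 (u : R -> R) : measurable_fun setT u ->
  (forall x, 0 <= u x <= 1) -> {homo u : s t / s <= t} -> 0 <= \int[g]_z (u z * z).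
Proof.
move=> mu_ u01 hu.
have uM x : `|u x| <= 1 by have /andP[a b] := u01 x; rewrite ger0_norm.
have E : \int[g]_z (u 0 * z) = 0.
  by rewrite (RintegralZl (u 0) measurableT integrable_gauss_id) Rintegral_gauss_id mulr0.
have i1 : g.-integrable setT (EFin \o (fun z : R => u 0 * z)).
  by apply: (@integrable_gauss_mul_id _ (cst (u 0)) 1) => // x; exact: uM.
rewrite -[leLHS]E; apply: (le_Rintegral measurableT i1 (integrable_gauss_mul_id mu_ uM)).
move=> z _; have [z0|z0] := leP 0 z.
  by rewrite ler_wpM2r// hu.
by rewrite ler_wnM2r ?(ltW z0)// hu// ltW.
Qed.

(** From [z <= exp (z - 1)], whose mean is [exp (- 1 / 2)]. The bound keeps the logarithms in the
    final ratio at least 1. *)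
Lemma moment_le1 (u : R -> R) : measurable_fun setT u ->
  (forall x, 0 <= u x <= 1) -> \int[g]_z (u z * z) <= 1.
Proof.
move=> mu_ u01.
have uM x : `|u x| <= 1 by have /andP[a b] := u01 x; rewrite ger0_norm.
apply: (@le_trans _ _ (\int[g]_z (expR (- 1) * expR (1 * z)))).
  have i1 : g.-integrable setT (EFin \o (fun z : R => expR (- 1) * expR (1 * z))).
    have := integrableZl measurableT (expR (- 1) : R) (integrable_gauss_expR 1).
    by apply: eq_integrable.
  apply: (le_Rintegral measurableT (integrable_gauss_mul_id mu_ uM) i1) => z _.
  rewrite -expRD mul1r.
  have := expR_ge1Dx (- 1 + z); have := expR_ge0 (- 1 + z); have := u01 z.
  by have [z0|z0] := leP 0 z; nra.
rewrite (RintegralZl _ measurableT (integrable_gauss_expR 1)).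
rewrite /Rintegral integral_gauss_expR /= -expRD -[leRHS]expR0 ler_expR; lra.
Qed.

(** * The truncated identity and the covariance bound *)

Definition clip (S x : R) : R := Num.max (- S) (Num.min x S).

Lemma clip_itv S x : 0 <= S -> - S <= clip S x <= S.
Proof.
move=> S0; rewrite /clip; apply/andP; split; first by rewrite le_max lexx.
by rewrite ge_max ge_min lexx orbT andbT; lra.
Qed.

Lemma clipP S x : 0 <= S ->
  [\/ x <= - S /\ clip S x = - S, - S <= x <= S /\ clip S x = x | S <= x /\ clip S x = S].
Proof.
move=> S0; rewrite /clip; case/boolP: (x <= - S) => [h1|]; last rewrite -ltNge => h1.
  by constructor 1; split => //; rewrite min_l ?max_l//; lra.
case/boolP: (x <= S) => [h2|]; last rewrite -ltNge => h2.
  constructor 2; split; first by rewrite (ltW h1).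
  by rewrite min_l// max_r// ltW.
by constructor 3; split; [exact: ltW|rewrite min_r ?max_r ?(ltW h2)//; lra].
Qed.

Lemma measurable_clip S : measurable_fun setT (clip S).
Proof.
by apply: measurable_maxr => //; exact: measurable_minr.
Qed.

(** Only the upper tail costs anything: below [- S] the truncation raises the integrand, because [u]
    is nonnegative. *)
Lemma moment_le_clip (S : R) (u : R -> R) : 0 <= S ->
  measurable_fun setT u -> (forall x, 0 <= u x <= 1) ->
  \int[g]_z (u z * z) <= \int[g]_z (u z * clip S z) + exp_tail S.
Proof.
move=> S0 mu_ u01; rewrite -Rintegral_exp_tail.
have uM x : `|u x| <= 1 by have /andP[a b] := u01 x; rewrite ger0_norm.
have i1 : g.-integrable setT (EFin \o (fun z => u z * clip S z)).
  apply: (@integrable_gauss_bounded _ _ S).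
    by apply: measurable_funM => //; exact: measurable_clip.
  move=> x; rewrite normrM -[leRHS]mul1r ler_pM//.
  by rewrite ler_norml; exact: clip_itv.
rewrite -(RintegralD measurableT i1 (integrable_exp_tail S)).
have i2 : g.-integrable setT
    (EFin \o (fun z => u z * clip S z + expR ((S + 1) * z - S ^+ 2))).
  by have := integrableD measurableT i1 (integrable_exp_tail S); apply: eq_integrable.
apply: (le_Rintegral measurableT (integrable_gauss_mul_id mu_ uM) i2) => z _.
have := expR_ge0 ((S + 1) * z - S ^+ 2).
have := u01 z; have [[? ->]|[_ ->]|[h ->]] := clipP z S0; [nra|lra|].
  move: h; rewrite le_eqVlt => /orP[/eqP ->|h]; first lra.
  have := ler_id_exp_tail S0 h; nra.
Qed.

Lemma Rintegral_clip S : 0 <= S -> \int[g]_z clip S z = 0.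
Proof.
move=> S0.
have ic : g.-integrable setT (EFin \o clip S).
  apply: (@integrable_gauss_bounded _ _ S); first exact: measurable_clip.
  by move=> x; rewrite ler_norml; exact: clip_itv.
have := RintegralN_gauss (measurable_clip S).
have E z : clip S (- z) = -1 * clip S z.
  by have := clipP z S0; have := clipP (- z) S0;
    move=> [[? ->]|[? ->]|[? ->]] [[? ->]|[? ->]|[? ->]]; lra.
under eq_Rintegral do rewrite E.
by rewrite (RintegralZl _ measurableT ic); lra.
Qed.

(** Inside the window [h] grows at least as fast as [k * clip S], and outside it [clip S] is
    constant, so [h - k * clip S] is nondecreasing and associated with [f]. *)
Lemma covariance_clip (S k : R) (f h : R -> R) : 0 <= S -> 0 <= k ->
  pos_bounded f -> pos_bounded h ->
  {homo f : s t / s <= t} -> {homo h : s t / s <= t} ->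
  (forall x' x, - S <= x' -> x' <= x -> x <= S -> k * (x - x') <= h x - h x') ->
  (\int[g]_x f x) * (\int[g]_x h x) + k * \int[g]_x (f x * clip S x) <=
  \int[g]_x (f x * h x).
Proof.
move=> S0 k0 bf bh hf hh slope.
have mc := measurable_clip S.
(* The constant [k * S] keeps [p] nonnegative, as [pos_bounded] demands; it contributes equally to
   both sides of the association inequality. *)
pose p x := h x + k * (S - clip S x).
have [mf [M fM]] := bf; have [mh [N hN]] := bh.
have mp : measurable_fun setT p.
  by apply: measurable_funD => //; apply: measurable_funM => //; exact: measurable_funB.
have bp : pos_bounded p.
  split => //; exists (N + k * (2 * S)) => x; rewrite /p.
  have /andP[c1 c2] := clip_itv x S0; have /andP[h1 h2] := hN x.
  apply/andP; split; first by rewrite addr_ge0// mulr_ge0//; lra.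
  by rewrite lerD// ler_wpM2l//; lra.
have hp : {homo p : s t / s <= t}.
  move=> x' x xx; rewrite /p.
  suff : k * (clip S x - clip S x') <= h x - h x' by lra.
  have hxx := hh _ _ xx.
  have := clipP x S0 => -[[xS ->]|[/andP[xS1 xS2] ->]|[xS ->]];
    have := clipP x' S0 => -[[x'S ->]|[/andP[x'S1 x'S2] ->]|[x'S ->]].
  - by rewrite subrr mulr0 subr_ge0.
  - have -> : - S - x' = 0 by lra.
    by rewrite mulr0 subr_ge0.
  - have : S = 0 by lra.
    by move=> ->; rewrite subr0 oppr0 mulr0 subr_ge0.
  - have := slope (- S) x; have := hh _ _ x'S; nra.
  - by apply: slope => //; lra.
  - have -> : x - S = 0 by lra.
    by rewrite mulr0 subr_ge0.
  - have := slope (- S) S; have := hh _ _ x'S; have := hh _ _ xS; nra.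
  - have := slope x' S; have := hh _ _ xS; nra.
  - by rewrite subrr mulr0 subr_ge0.
have := gauss_association bf bp hf hp.
have ih := pos_bounded_integrable bh.
have jf := pos_bounded_integrable bf.
have ic : g.-integrable setT (EFin \o clip S).
  apply: (@integrable_gauss_bounded _ _ S) => //.
  by move=> x; rewrite ler_norml; exact: clip_itv.
have i1 : g.-integrable setT (EFin \o (fun x : R => k * S + h x)).
  have := integrableD measurableT (finite_measure_integrable_cst g (k * S) measurableT) ih.
  by apply: eq_integrable.
have i2 : g.-integrable setT (EFin \o (fun x => k * clip S x)).
  by have := integrableZl measurableT k ic; apply: eq_integrable.
have -> : \int[g]_x p x = k * S + \int[g]_x h x.
  rewrite (_ : p = fun x => (k * S + h x) - k * clip S x); last first.
    by apply/funext => x; rewrite /p; ring.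
  rewrite (RintegralB measurableT i1 i2) (RintegralZl _ measurableT ic).
  rewrite Rintegral_clip// mulr0 subr0.
  rewrite (RintegralD measurableT (finite_measure_integrable_cst g (k * S) measurableT) ih).
  by rewrite Rintegral_gauss_cst.
have jc : g.-integrable setT (EFin \o (fun x => f x * clip S x)).
  apply: (@integrable_gauss_bounded _ _ (M * S)); first exact: measurable_funM.
  move=> x; rewrite normrM; have /andP[f0 f1] := fM x.
  apply: ler_pM => //; first by rewrite ger0_norm.
  by rewrite ler_norml; exact: clip_itv.
have j1 : g.-integrable setT (EFin \o (fun x => (k * S) * f x)).
  by have := integrableZl measurableT (k * S) jf; apply: eq_integrable.
have j2 := pos_bounded_integrable (pos_boundedM bf bh).
have j3 : g.-integrable setT (EFin \o (fun x => (k * S) * f x + f x * h x)).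
  by have := integrableD measurableT j1 j2; apply: eq_integrable.
have j4 : g.-integrable setT (EFin \o (fun x => k * (f x * clip S x))).
  by have := integrableZl measurableT k jc; apply: eq_integrable.
have -> : \int[g]_x (f x * p x) = k * S * (\int[g]_x f x) + \int[g]_x (f x * h x)
    - k * \int[g]_x (f x * clip S x).
  rewrite -(RintegralZl _ measurableT jc) -(RintegralZl _ measurableT jf).
  rewrite -(RintegralD measurableT j1 j2) -(RintegralB measurableT j3 j4).
  by apply: eq_Rintegral => x _; rewrite /p; ring.
lra.
Qed.

(** Factor [ou (r * s)] as [ou r] after [ou s] and move [ou r] onto [f] by symmetry. What remains is
    association at correlation [s] for the nondecreasing functions [ou r f] and [u]. *)
Lemma ou_decreasing_correlation (r s : R) (f u : R -> R) : r ^+ 2 <= 1 -> s ^+ 2 <= 1 ->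
  0 <= r -> pos_bounded f -> pos_bounded u ->
  {homo f : s t / s <= t} -> {homo u : s t / s <= t} ->
  \int[g]_x (f x * ou (r * s) u x) <= \int[g]_x (f x * ou r u x).
Proof.
move=> r1 s1 r0 bf bu hf hu.
rewrite [leRHS]ou_sym//.
under eq_Rintegral do rewrite -ou_comp//.
rewrite [leLHS]ou_sym//; last exact: pos_bounded_ou.
apply: ou_association => //; first exact: pos_bounded_ou.
exact: ou_homo.
Qed.

Lemma ou_talagrand (r : R) (f u : R -> R) : 0 <= r <= 1 ->
  measurable_fun setT f -> measurable_fun setT u ->
  (forall x, 0 <= f x <= 1) -> (forall x, 0 <= u x <= 1) ->
  {homo f : s t / s <= t} -> {homo u : s t / s <= t} ->
  let a := \int[g]_x (f x * x) in let b := \int[g]_x (u x * x) in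
  0 < a -> 0 < b ->
  expR (- 2) / 512 * (r * a * b / (Num.sqrt (ln (expR 1 / a ^+ 2)) *
    Num.sqrt (ln (expR 1 / b ^+ 2)))) <=
  \int[g]_x (f x * ou r u x) - (\int[g]_x f x) * (\int[g]_x u x).
Proof.
move=> /andP[r0 r1] mf mu_ f01 u01 hf hu a b a0 b0.
have bf : pos_bounded f by split => //; exists 1.
have bu : pos_bounded u by split => //; exists 1.
have a1 : a <= 1 by exact: moment_le1.
have b1 : b <= 1 by exact: moment_le1.
have aC S : 0 <= S -> a <= \int[g]_x (f x * clip S x) + exp_tail S.
  by move=> S0; exact: moment_le_clip.
have bB T : 0 <= T -> b <= \int[g]_z odd_trunc u T z + exp_tail T.
  by move=> T0; exact: moment_le_odd_trunc.
clearbody a b.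
have [S [S1 tS SL]] := exists_cutoff a0 a1.
have [T [T1 tT TL]] := exists_cutoff b0 b1.
move: SL TL; set La := Num.sqrt _; set Lb := Num.sqrt _ => SL TL.
have S0 : 0 < S by lra.
have T0 : 0 < T by lra.
(* The largest factor with [s S T <= 1 / 2]; as [S] and [T] are at least 1, it also keeps [s], [s S]
   and [s T] below [1 / 2]. *)
pose s := (2 * S * T)^-1.
have ST1 : 1 <= S * T by nra.
have s0 : 0 <= s by rewrite invr_ge0; nra.
have sST : s * S * T = 1 / 2 by rewrite /s; field; lra.
have sS : s * S <= 1 / 2 by rewrite -sST ler_peMr// mulr_ge0// ltW.
have sT : s * T <= 1 / 2 by rewrite -sST mulrAC ler_peMr// mulr_ge0// ltW.
have s1 : s <= 1 / 2 by apply: le_trans sS; rewrite ler_peMr.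
have rs0 : 0 <= r * s by exact: mulr_ge0.
have rss : r * s <= s by rewrite ler_piMl.
have r21 : r ^+ 2 <= 1 by nra.
have s21 : s ^+ 2 <= 1 by nra.
have rs21 : (r * s) ^+ 2 <= 1 by nra.
have hh := ou_homo rs0 bu hu.
have bh := pos_bounded_ou (r * s) bu.
have rsS : r * s * S <= 1 / 2.
  by apply: le_trans sS; rewrite ler_wpM2r// ltW.
have rsT : r * s * T <= 1 / 2.
  by apply: le_trans sT; rewrite ler_wpM2r// ltW.
have rsST : r * s * S * T <= 1 / 2.
  by rewrite -sST !ler_wpM2r// ltW.
have rs01 : 0 <= r * s <= 1 / 2 by rewrite rs0 (le_trans rss).
have := ou_slope rs01 rsS rsT rsST (ltW T0) _ _ _ mu_ u01 hu.
move: (bB T (ltW T0)); move: (\int[g]_z odd_trunc u T z) => B {}bB slope.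
have B0 : b / 2 <= B by lra.
pose k := expR (- 2) * (r * s) / 4 * B.
have k0 : 0 <= k.
  apply: mulr_ge0; last lra.
  by apply: mulr_ge0 => //; apply: mulr_ge0 => //; exact: expR_ge0.
have H1 := covariance_clip (ltW S0) k0 bf bh hf hh
  (fun x' x h1 h2 h3 => slope x x' h1 h2 h3).
rewrite Rintegral_ou// in H1.
have H2 := ou_decreasing_correlation r21 s21 r0 bf bu hf hu.
apply: le_trans (lerB H2 (lexx _)); rewrite lerBrDl; apply: le_trans H1.
rewrite lerD2l {H2}.
move: (aC S (ltW S0)); move: (\int[g]_x (f x * clip S x)) => C {}aC.
have C0 : a / 2 <= C by lra.
have La0 : 0 < La by lra.
have Lb0 : 0 < Lb by lra.
apply: (@le_trans _ _ (expR (- 2) * (r * s) / 4 * (b / 2) * (a / 2))); last first.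
  apply: ler_pM => //; [|lra|].
    by apply: mulr_ge0; [apply: mulr_ge0 => //; apply: mulr_ge0 => //; exact: expR_ge0|lra].
  rewrite ler_wpM2l//; apply: mulr_ge0 => //; apply: mulr_ge0 => //; exact: expR_ge0.
(* Cut-offs at most [4 La] and [4 Lb] give [2 S T <= 32 La Lb]; with the [1 / 16] below this makes
   512. *)
have sL : (32 * (La * Lb))^-1 <= s.
  rewrite /s lef_pV2 ?posrE ?mulr_gt0//.
  have : S * T <= (4 * La) * (4 * Lb) by rewrite ler_pM// ltW.
  lra.
have -> : expR (- 2) / 512 * (r * a * b / (La * Lb)) =
    expR (- 2) * r * a * b / 16 * (32 * (La * Lb))^-1 by field; lra.
have -> : expR (- 2) * (r * s) / 4 * (b / 2) * (a / 2) = expR (- 2) * r * a * b / 16 * s by field.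
rewrite ler_wpM2l//.
by rewrite !mulr_ge0// ?expR_ge0// ltW.
Qed.

End one_dimensional.

(** * Reduction to a correlated pair *)

Section reduction.
Context {R : realType}.
Local Notation g := (@normal_prob R 0 1).

Lemma norm2_eq1 (n : nat) (w : n.-tuple R) : norm2 w = 1 -> dotp w w = 1.
Proof.
rewrite /norm2 => w1; have [h|h] := leP 0 (dotp w w).
  by rewrite -(sqr_sqrtr h) w1 expr1n.
by move: w1; rewrite ltr0_sqrtr// => /esym/eqP; rewrite oner_eq0.
Qed.

Lemma std_gaussian_dotp2 (n : nat) (w v : n.-tuple R) : dotp w w = 1 ->
  exists2 k : R, 0 <= k /\ dotp w v ^+ 2 + k ^+ 2 = dotp v v &
  forall F : R * R -> \bar R, measurable_fun setT F -> (forall x, (0 <= F x)%E) ->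
  (\int[std_gaussian R n]_x F (dotp w x, dotp v x) =
   \int[g]_x \int[g]_y F (x, (dotp w v * x + k * y)%R))%E.
Proof.
move=> w1; have [a [b [k [[a0 k0 a2 ab bk] H]]]] := std_gaussian_dotp2_ge0 w v.
have a1 : a = 1.
  by apply/eqP; rewrite -(@eqrXn2 _ 2)// a2 w1 expr1n.
rewrite a1 mul1r in ab; exists k; first by rewrite -ab.
move=> F mF F0; rewrite (H F mF F0) a1 ab.
by apply: eq_integral => x _; rewrite mul1r.
Qed.

Lemma gexp_mul (n : nat) (w v : n.-tuple R) (f u : R -> R) :
  dotp w w = 1 -> dotp v v = 1 -> pos_bounded f -> pos_bounded u ->
  gexp (fun x => f (dotp w x) * u (dotp v x)) = \int[g]_x (f x * ou (dotp w v) u x).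
Proof.
move=> w1 v1 bf bu; have [k [k0 k2] H] := std_gaussian_dotp2 v w1.
have kE : k = Num.sqrt (1 - dotp w v ^+ 2).
  by rewrite -v1 -k2 addrAC subrr add0r sqrtr_sqr ger0_norm.
have [mf [M fM]] := bf; have [mu_ [N uN]] := bu.
rewrite /gexp unlock.
have mF : measurable_fun setT (fun p : R * R => (f p.1 * u p.2)%:E).
  by apply/measurable_EFinP; apply: measurable_funM; exact: measurableT_comp.
have F0 p : (0 <= (f p.1 * u p.2)%:E)%E.
  have /andP[? _] := fM p.1; have /andP[? _] := uN p.2.
  by rewrite lee_fin mulr_ge0.
by rewrite (H _ mF F0) kE /= integral_mul_ou.
Qed.

Lemma gexp_dotp (n : nat) (w : n.-tuple R) (f : R -> R) : dotp w w = 1 ->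
  pos_bounded f -> gexp (fun x => f (dotp w x)) = \int[g]_x f x.
Proof.
move=> w1 bf; have := gexp_mul w1 w1 bf (pos_bounded_cst ler01).
move=> H; transitivity (\int[g]_x (f x * ou (dotp w w) (cst 1) x)).
  rewrite -H; congr gexp; apply/funext => x; by rewrite mulr1.
by apply: eq_Rintegral => x _; rewrite ou_cst mulr1.
Qed.

(** A coordinate is signed and unbounded, so Fubini needs integrability. Since [e >= 1], the product
    [e x * e y] dominates both [|x|] and [|y|], and its integral factorises. *)
Lemma integrable_prod_gauss (f : R -> R) (b k : R) :
  measurable_fun setT f -> (forall x, 0 <= f x <= 1) ->
  (g \x g)%E.-integrable setT
    (fun p : measurableTypeR R * measurableTypeR R => (f p.1 * (b * p.1 + k * p.2))%:E).
Proof.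
move=> mf f01.
pose e (z : R) := expR z + expR (- z).
have e0 z : 0 <= e z by rewrite addr_ge0// expR_ge0.
have e1 z : 1 <= e z.
  rewrite /e; have := expR_ge1Dx z; have := expR_ge1Dx (- z).
  have := expR_ge0 z; have := expR_ge0 (- z); lra.
have me : measurable_fun setT e.
  by apply: measurable_funD; [|apply: measurableT_comp => //; exact: measurableT_comp].
have mP : measurable_fun setT (fun p : R * R => (f p.1 * (b * p.1 + k * p.2))%:E).
  apply/measurable_EFinP; apply: measurable_funM.
    by apply: measurableT_comp.
  by apply: measurable_funD; exact: measurable_funM.
pose K := `|b| + `|k|.
have mQ : measurable_fun setT (fun p : R * R => (K * (e p.1 * e p.2))%:E).
  apply/measurable_EFinP; apply: measurable_funM => //.
  by apply: measurable_funM; apply: measurableT_comp.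
apply: (@le_integrable _ _ _ (g \x g)%E setT measurableT _
  (fun p : R * R => (K * (e p.1 * e p.2))%:E)) => //.
- move=> p _; rewrite /= lee_fin normrM.
  have -> : `|K * (e p.1 * e p.2)| = K * (e p.1 * e p.2).
    by rewrite ger0_norm// mulr_ge0 ?mulr_ge0// addr_ge0.
  have /andP[f0 f1] := f01 p.1.
  rewrite (ger0_norm f0) -[leRHS]mul1r ler_pM// (le_trans (ler_normD _ _))//.
  rewrite !normrM mulrDl; apply: lerD; rewrite ler_wpM2l//.
    by rewrite -[leLHS]mulr1 ler_pM// ler_norm_expR.
  by rewrite -[leLHS]mul1r ler_pM// ler_norm_expR.
- apply: (proj2 (@integrable12ltyP _ _ _ _ R g g _ mQ)).
  have ie := @integrable_gauss_expRD R.
  pose I := \int[g]_z e z.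
  have IE : (\int[g]_z (e z)%:E = I%:E)%E by rewrite fineK//; exact: integrable_fin_num.
  suff -> : (\int[g]_x \int[g]_y `|(K * (e x * e y))%:E| = (K * I * I)%:E)%E by exact: ltry.
  transitivity (\int[g]_x ((K * I)%:E * (e x)%:E))%E.
    apply: eq_integral => x _.
    transitivity (\int[g]_y ((K * e x)%:E * (e y)%:E))%E.
      apply: eq_integral => y _; rewrite /= ger0_norm; first by rewrite -EFinM mulrA.
      by rewrite mulr_ge0 ?mulr_ge0// addr_ge0.
    by rewrite (integralZl measurableT ie) IE -!EFinM mulrAC.
  by rewrite (integralZl measurableT ie) IE -!EFinM.
Qed.

(** Pair [w] with the [i]-th basis vector: the coordinate becomes [tnth w i] times [dotp w x] plus
    an independent centred normal, whose contribution vanishes. *)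
Lemma gexp_coord (n : nat) (w : n.-tuple R) (f : R -> R) (i : 'I_n) :
  dotp w w = 1 -> measurable_fun setT f -> (forall x, 0 <= f x <= 1) ->
  gexp (fun x => f (dotp w x) * tnth x i) = tnth w i * \int[g]_x (f x * x).
Proof.
move=> w1 mf f01.
pose v : n.-tuple R := [tuple (j == i)%:R | j < n].
have dv (x : n.-tuple R) : dotp v x = tnth x i.
  rewrite /dotp (bigD1 i)//= tnth_mktuple eqxx mul1r big1 ?addr0// => j ji.
  by rewrite tnth_mktuple (negbTE ji) mul0r.
have wv : dotp w v = tnth w i.
  by rewrite -dv /dotp; apply: eq_bigr => j _; rewrite mulrC.
have [k _ H] := std_gaussian_dotp2 v w1.
rewrite wv in H.
pose b := tnth w i.
pose Phi (p : R * R) := (f p.1 * p.2)%:E.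
have mPhi : measurable_fun setT Phi.
  apply/measurable_EFinP; apply: measurable_funM => //.
  by apply: measurableT_comp.
pose L (p : measurableTypeR R * measurableTypeR R) : R * R := (p.1, b * p.1 + k * p.2).
have mL : measurable_fun setT L.
  apply: measurable_fun_pair => //.
  by apply: measurable_funD; exact: measurable_funM.
have iPhi := integrable_prod_gauss b k mf f01.
rewrite /gexp unlock.
(* The joint law is known only for nonnegative integrands, so the positive and negative parts are
   transferred separately. *)
transitivity (fine (\int[g \x g]_p Phi (L p))%E).
  congr fine; rewrite [LHS]integralE [RHS]integralE; congr (_ - _)%E.
    transitivity (\int[std_gaussian R n]_x (Phi ^\+ (dotp w x, dotp v x)))%E.
      by apply: eq_integral => x _; rewrite !funeposE dv.
    rewrite (H _ (measurable_funepos mPhi) (fun p => funepos_ge0 _ p)).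
    transitivity (\int[g \x g]_p (Phi ^\+ (L p)))%E; last first.
      by apply: eq_integral => x _; rewrite !funeposE.
    rewrite (fubini_tonelli1 (Phi^\+ \o L)%E)//.
      exact: (measurableT_comp (measurable_funepos mPhi) mL).
    by move=> p; exact: funepos_ge0.
  transitivity (\int[std_gaussian R n]_x (Phi ^\- (dotp w x, dotp v x)))%E.
    by apply: eq_integral => x _; rewrite !funenegE dv.
  rewrite (H _ (measurable_funeneg mPhi) (fun p => funeneg_ge0 _ p)).
  transitivity (\int[g \x g]_p (Phi ^\- (L p)))%E; last first.
    by apply: eq_integral => x _; rewrite !funenegE.
  rewrite (fubini_tonelli1 (Phi^\- \o L)%E)//.
    exact: (measurableT_comp (measurable_funeneg mPhi) mL).
  by move=> p; exact: funeneg_ge0.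
rewrite -(integral12_prod_meas1 iPhi) /fubini_F /=.
have fM x : `|f x| <= 1 by have /andP[? ?] := f01 x; rewrite ger0_norm.
have ifx := integrable_gauss_mul_id mf fM.
rewrite -(RintegralZl b measurableT ifx) /Rintegral; congr fine.
apply: eq_integral => x _.
have ic : g.-integrable setT (EFin \o (fun _ : R => f x * (b * x))).
  exact: finite_measure_integrable_cst.
have iy : g.-integrable setT (EFin \o (fun y : R => f x * k * y)).
  by apply: (@integrable_gauss_mul_id _ (cst (f x * k)) `|f x * k|).
have iD : g.-integrable setT (EFin \o (fun y : R => f x * (b * x) + f x * k * y)).
  by have := integrableD measurableT ic iy; apply: eq_integrable.
transitivity (\int[g]_y (f x * (b * x) + f x * k * y)%:E)%E.
  by apply: eq_integral => y _; congr EFin; ring.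
rewrite -[LHS]fineK; last exact: integrable_fin_num.
congr EFin; rewrite -/(Rintegral _ _ _) (RintegralD measurableT ic iy).
rewrite Rintegral_gauss_cst (RintegralZl (f x * k) measurableT integrable_gauss_id).
by rewrite Rintegral_gauss_id; ring.
Qed.

Lemma W1_dotp (n : nat) (w v : n.-tuple R) (f u : R -> R) :
  dotp w w = 1 -> dotp v v = 1 ->
  measurable_fun setT f -> (forall x, 0 <= f x <= 1) ->
  measurable_fun setT u -> (forall x, 0 <= u x <= 1) ->
  W1 (fun x => f (dotp w x)) (fun x => u (dotp v x)) =
  dotp w v * (\int[g]_x (f x * x)) * (\int[g]_x (u x * x)).
Proof.
move=> w1 v1 mf f01 mu_ u01.
rewrite /W1 /dotp !mulr_suml; apply: eq_bigr => i _.
by rewrite !gexp_coord//; ring.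
Qed.

End reduction.

Unset Implicit Arguments.

Theorem theorem4 (R : realType) :
  exists c : R, 0 < c /\
    forall (n : nat) (w v : n.-tuple R) (f g : R -> R),
      (1 <= n)%N ->
      norm2 w = 1 -> norm2 v = 1 -> 0 <= dotp w v ->
      (forall t, 0 <= f t <= 1) -> (forall t, 0 <= g t <= 1) ->
      {homo f : s t / s <= t} -> {homo g : s t / s <= t} ->
      (forall t, f s @[s --> t^'-] --> f t) ->
      (forall t, g s @[s --> t^'-] --> g t) ->
      let F := fun x : n.-tuple R => f (dotp w x) in
      let G := fun x : n.-tuple R => g (dotp v x) in
      gcov F G >= c * talagrand_ratio F G.
Proof.
exists (expR (- 2) / 512); split.
  by apply: divr_gt0; [exact: expR_gt0|rewrite ltr0n].
move=> n w v f u _ /norm2_eq1 w1 /norm2_eq1 v1 wv0 f01 u01 hf hu _ _.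
cbv beta zeta.
have mf : measurable_fun setT f by apply: nondecreasing_measurable => // x y xy; exact: hf.
have mu_ : measurable_fun setT u by apply: nondecreasing_measurable => // x y xy; exact: hu.
have bf : pos_bounded f by split => //; exists 1.
have bu : pos_bounded u by split => //; exists 1.
(* Cauchy-Schwarz, read off from [k^2 >= 0] in the joint law. *)
have wv1 : dotp w v ^+ 2 <= 1.
  have [k [_ wvk] _] := std_gaussian_dotp2 v w1.
  by have := sqr_ge0 k; rewrite v1 in wvk; lra.
rewrite /gcov (gexp_mul w1 v1 bf bu) (gexp_dotp w1 bf) (gexp_dotp v1 bu).
rewrite /talagrand_ratio !W1_dotp// w1 v1 !mul1r -!expr2.
(* In the degenerate case the ratio is 0 by convention, and the covariance is nonnegative by
   association of [ou (dotp w v) f] with [u]. *)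
have [ab0|] := boolP (_ || _).
  rewrite mulr0 subr_ge0 ou_sym//.
  rewrite -[X in X * _](Rintegral_ou wv1 bf).
  apply: gauss_association => //; first exact: pos_bounded_ou.
  exact: ou_homo.
rewrite negb_or !sqrf_eq0 => /andP[a0 b0].
apply: ou_talagrand => //.
- by rewrite wv0/= -(@expr_le1 _ 2).
- by rewrite lt_neqAle eq_sym a0 moment_ge0.
- by rewrite lt_neqAle eq_sym b0 moment_ge0.
Qed.
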